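(* Fix $\gamma>0$. Let $(V_M)_{M\ge1}$ be a sequence of finite-dimensional spaces with $V_M\subset L_0^2(\mu)$, let $\Pi_M$ be the orthogonal projector of $L^2(\mu)$ onto $V_M$, and assume that $$\big\|(A+A^* )(1-\Pi_M)\mathcal L\,\Pi_M\big\|\xrightarrow[M\to\infty]{}0 .$$ Then there exist $C\ge1$ (independent of $M$ and $\gamma$), $M_0\in\mathbb N$, and, for $M\ge M_0$, numbers $\lambda_{\gamma,M}>0$ with $\lambda_{\gamma,M}\to\lambda_\gamma$ as $M\to\infty$ and $\|\mathrm e^{t\Pi_M\mathcal L\Pi_M}\varphi\|\le C\mathrm e^{-\lambda_{\gamma,M}t}\|\varphi\|$ for all $\varphi\in V_M$, $t\ge0$, such that for any $M\ge M_0$ the operator $\Pi_M\mathcal L\Pi_M$ is invertible on $V_M$, the following equality holds in $\mathcal B(V_M)$ (bounded operators on $V_M$): $$(\Pi_M\mathcal L\Pi_M)^{-1}=-\int_0^\infty \mathrm e^{t\,\Pi_M\mathcal L\Pi_M}\,dt,$$ and moreover $$\big\|(\Pi_M\mathcal L\Pi_M)^{-1}\big\|_{\mathcal B(V_M)}\le\frac{C}{\lambda_{\gamma,M}} .$$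
   Context: Setting. $D\ge 1$ is an integer; the position space $\mathcal D$ is either a torus $(a\mathbb T)^D$, $\mathbb T=\mathbb R/\mathbb Z$, $a>0$, or $\mathbb R^D$; $\beta,m,\gamma>0$; $V:\mathcal D\to\mathbb R$ is smooth with $\mathrm e^{-\beta V}$ integrable. Probability measures: $\mu(dq\,dp)=Z_\mu^{-1}\mathrm e^{-\beta(V(q)+|p|^2/(2m))}dq\,dp$ on $\mathcal D\times\mathbb R^D$, with marginals $\nu(dq)=Z_\nu^{-1}\mathrm e^{-\beta V(q)}dq$ and $\kappa(dp)=(\beta/(2\pi m))^{D/2}\mathrm e^{-\beta|p|^2/(2m)}dp$. $\langle\cdot,\cdot\rangle$ and $\|\cdot\|$ are the scalar product and norm of $L^2(\mu)$, also $\|\cdot\|$ denotes the operator norm on $L^2(\mu)$, and $^*$ is the adjoint on $L^2(\mu)$. $L_0^2(\mu)=\{\varphi\in L^2(\mu):\int\varphi\,d\mu=0\}$, and $\Pi_0\varphi=\varphi-\int\varphi\,d\mu$. Standing assumption on $V$: there is $C_\nu>0$ with $\|\varphi-\int\varphi\,d\nu\|_{L^2(\nu)}^2\le C_\nu^{-1}\|\nabla_q\varphi\|^2_{L^2(\nu)}$ for all $\varphi\in H^1(\nu)$, and there are $c_1>0$, $c_2\in[0,1)$, $c_3>0$ with $\Delta V\le c_1+\frac{c_2}{2}|\nabla V|^2$ and $|\nabla^2V|\le c_3(1+|\nabla V|)$. Operators: $\mathcal L=\mathcal L_{\mathrm{ham}}+\gamma\mathcal L_{\mathrm{FD}}$ (generator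 of the Langevin dynamics, a closed operator on $L^2(\mu)$), with $\mathcal L_{\mathrm{ham}}=\frac{p}{m}\cdot\nabla_q-\nabla V\cdot\nabla_p$ and $\mathcal L_{\mathrm{FD}}=-\frac pm\cdot\nabla_p+\frac1\beta\Delta_p$. $(\Pi_p\varphi)(q)=\int_{\mathbb R^D}\varphi(q,p)\,\kappa(dp)$. The bounded operator $A$ is $A=\big(1+(\mathcal L_{\mathrm{ham}}\Pi_p)^*(\mathcal L_{\mathrm{ham}}\Pi_p)\big)^{-1}(\mathcal L_{\mathrm{ham}}\Pi_p)^*$. The elements of $V_M$ are assumed regular enough (in the domain of $\mathcal L$) for $\mathcal L\Pi_M$ to be defined. Constants (from known hypocoercivity results). There exist $\overline\varepsilon\in(0,1)$, $\overline\lambda>0$ and, for each $\gamma>0$, $\widetilde\lambda_\gamma>0$ such that, with $\varepsilon=\overline\varepsilon\min(\gamma,\gamma^{-1})$, for all $\varphi\in\Pi_0C_c^\infty(\mathcal D\times\mathbb R^D)$, $$\langle-\mathcal L\varphi,\varphi\rangle+\varepsilon\langle A\mathcal L\varphi,\varphi\rangle+\varepsilon\langle A\varphi,\mathcal L\varphi\rangle\ \ge\ \widetilde\lambda_\gamma\|\varphi\|^2 .$$ These are fixed, and $\lambda_\gamma:=\widetilde\lambda_\gamma/(1+\varepsilon)$, with $\lambda_\gamma\ge\overline\lambda\min(\gamma,\gamma^{-1})$. The rate $\lambda_\gamma$ is the one for which $\|\mathrm e^{t\mathcal L}\varphi\|\le C\mathrm e^{-\lambda_\gamma t}\|\varphi\|$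 for all $\varphi\in L_0^2(\mu)$, $t\ge0$, with $C$ independent of $\gamma$. *)

(* Defs.v *)
From HB Require Import structures.
From mathcomp Require Import all_boot all_order all_algebra.
From mathcomp Require Import lra.
From mathcomp Require Import all_classical all_reals all_analysis measurable_realfun.
Set Implicit Arguments. Unset Strict Implicit. Unset Printing Implicit Defensive.
Import Order.TTheory GRing.Theory Num.Theory.
Import numFieldNormedType.Exports.
Local Open Scope classical_set_scope.
Local Open Scope ring_scope.

Definition rV_display : measure_display.
Proof. exact: default_measure_display. Qed.

(* R^n with the product sigma-algebra; by open_measurable_rV it is the Borel one *)
Section rV_measurable.
Variables (R : realType) (n : nat).

Let coords : 'I_n -> 'rV[R]_n -> measurableTypeR R := fun i x => x ord0 i.

Let rV_set0 : g_sigma_preimage coords set0.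
Proof. exact: sigma_algebra0. Qed.

Let rV_setC A : g_sigma_preimage coords A -> g_sigma_preimage coords (~` A).
Proof. exact: sigma_algebraC. Qed.

Let rV_bigcup (F : (set 'rV[R]_n)^nat) :
  (forall i, g_sigma_preimage coords (F i)) ->
  g_sigma_preimage coords (\bigcup_i F i).
Proof. exact: sigma_algebra_bigcup. Qed.

HB.instance Definition _ := @isMeasurable.Build rV_display 'rV[R]_n
  (g_sigma_preimage coords) rV_set0 rV_setC rV_bigcup.

Lemma measurable_coord (i : 'I_n) :
  measurable_fun [set: 'rV[R]_n]
    (fun x : 'rV[R]_n => x ord0 i : measurableTypeR R).
Proof.
move=> _ Y mY; rewrite setTI; apply: sub_sigma_algebra => /=.
rewrite -bigcup_seq/=; exists i => /=; first by rewrite mem_index_enum.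
by exists Y => //; rewrite setTI.
Qed.

Lemma measurable_fun_rV d (T : measurableType d) (f : T -> 'rV[R]_n) :
  (forall i, measurable_fun [set: T]
     (fun t => f t ord0 i : measurableTypeR R)) ->
  measurable_fun [set: T] f.
Proof.
move=> mf _ Y mY; rewrite setTI.
suff : g_sigma_preimage coords `<=` [set A | measurable (f @^-1` A)].
  by move=> /(_ _ mY).
apply: smallest_sub.
  split => /= [|A mA|F mF].
  - by rewrite preimage_set0; exact: measurable0.
  - by rewrite setTD preimage_setC; exact: measurableC.
  - by rewrite preimage_bigcup; exact: bigcupT_measurable.
rewrite -bigcup_seq => A [i _] [B mB <-] /=.
by rewrite setTI -[X in measurable X]setTI; exact: (mf i).
Qed.

Lemma open_measurable_rV (U : set 'rV[R]_n) : open U -> measurable U.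
Proof.
move=> oU.
pose B (qe : 'rV[rat]_n * rat) : set 'rV[R]_n :=
  [set x | forall i, `|ratr (qe.1 ord0 i) - x ord0 i| < ratr qe.2].
have mB qe : measurable (B qe).
  have -> : B qe = \big[setI/setT]_(i < n)
      [set x | `|ratr (qe.1 ord0 i) - x ord0 i| < ratr qe.2].
    rewrite -bigcap_seq; apply/seteqP; split => [x Bx i _|x Bx i].
      exact: Bx.
    by apply: Bx; rewrite /= mem_index_enum.
  elim/big_ind : _ => [||i _];
    [exact: measurableT|by move=> A1 A2 m1 m2; apply: measurableI|].
  set r : R := ratr (qe.1 ord0 i).
  rewrite [X in measurable X](_ : _ = (fun x : 'rV[R]_n => x ord0 i) @^-1`
      `]r - ratr qe.2, r + ratr qe.2[); last first.
    by apply/seteqP; split => x /=; rewrite in_itv/= ltr_distlC.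
  rewrite -[X in measurable X]setTI; apply: measurable_coord => //.
pose I := [set qe | B qe `<=` U].
have -> : U = \bigcup_(qe in I) B qe.
  apply/seteqP; split => [x Ux|x [qe]]; last by move=> /[apply].
  have /nbhs_ballP[e /= e0 xe] := oU x Ux.
  have [k kI] : exists k : rat, 0 < (ratr k : R) < e / 2.
    have /rat_in_itvoo[k] : 0 < e / 2 by rewrite divr_gt0.
    by rewrite in_itv/=; exists k.
  move: kI => /andP[k0 ke].
  have qP i : exists q : rat, `|ratr q - x ord0 i| < ratr k.
    have /rat_in_itvoo[q] : x ord0 i - ratr k < x ord0 i + ratr k by lra.
    rewrite in_itv/= => qI; exists q.
    by rewrite distrC ltr_distlC.
  pose q := \row_i (projT1 (cid (qP i))).
  exists (q, k); last first.
    by move=> i /=; rewrite mxE; case: cid.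
  move=> y By; apply: xe; split => // i j; rewrite (ord1 i).
  have := By j; rewrite /= mxE; case: cid => /= q0 q0x q0y.
  rewrite -ball_normE /ball_/=.
  rewrite (le_lt_trans (ler_distD (ratr q0) _ _))//.
  by move: q0x; rewrite distrC => q0x; lra.
rewrite bigcup_mkcond; apply: countable_bigcupT_measurable => //.
by move=> qe; case: ifPn.
Qed.

Lemma continuous_measurable_rV (f : 'rV[R]_n -> R) : continuous f ->
  measurable_fun setT (f : 'rV[R]_n -> measurableTypeR R).
Proof.
move=> /continuousP cf.
apply: (measurability _ (RGenOpens.measurableE R)).
move=> _ [_ [a [b ->] <-]]; rewrite setTI; apply: open_measurable_rV.
exact/cf/interval_open.
Qed.
End rV_measurable.

Section lebesgue_rV.
Variables (R : realType) (n : nat).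
Variable mu : {sigma_finite_measure set 'rV[R]_n -> \bar R}.

Definition rV_cons (x : measurableTypeR R * 'rV[R]_n) : 'rV[R]_n.+1 :=
  \row_(i < n.+1) oapp (fun j => x.2 ord0 j) x.1 (unlift ord0 i).

Definition rV_split (x : 'rV[R]_n.+1) : measurableTypeR R * 'rV[R]_n :=
  (x ord0 ord0, \row_(j < n) x ord0 (lift ord0 j)).

Lemma rV_consK : cancel rV_cons rV_split.
Proof.
case=> a y; rewrite /rV_split /rV_cons; congr pair.
  by rewrite mxE unlift_none.
by apply/rowP => j; rewrite !mxE liftK.
Qed.

Lemma measurable_rV_cons : measurable_fun setT rV_cons.
Proof.
apply: measurable_fun_rV => i.
rewrite (_ : (fun _ => _) = fun x : measurableTypeR R * 'rV[R]_n =>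
    oapp (fun j => x.2 ord0 j : measurableTypeR R) x.1 (unlift ord0 i)).
  case: (unlift ord0 i) => [j|] /=; last exact: measurable_fst.
  exact: (measurableT_comp (measurable_coord j)).
by apply/funext => x; rewrite mxE.
Qed.

Lemma measurable_rV_split : measurable_fun setT rV_split.
Proof.
apply/measurable_fun_pairP; split; first exact: measurable_coord.
apply: measurable_fun_rV => i.
rewrite (_ : (fun _ => _) = fun x : 'rV[R]_n.+1 =>
    x ord0 (lift ord0 i) : measurableTypeR R); first exact: measurable_coord.
by apply/funext => x; rewrite mxE.
Qed.

Definition lebesgue_cons : set 'rV[R]_n.+1 -> \bar R :=
  pushforward (@lebesgue_measure R \x mu)%E rV_cons.

Let lebesgue_cons0 : lebesgue_cons set0 = 0%E.
Proof. by rewrite /lebesgue_cons /pushforward preimage_set0 measure0. Qed.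

Let lebesgue_cons_ge0 A : (0 <= lebesgue_cons A)%E.
Proof. by rewrite /lebesgue_cons /pushforward; exact: measure_ge0. Qed.

Let lebesgue_cons_sigma_additive : semi_sigma_additive lebesgue_cons.
Proof.
move=> F mF tF mUF; rewrite /lebesgue_cons /pushforward preimage_bigcup.
have mp A : measurable A -> measurable (rV_cons @^-1` A).
  by move=> mA; rewrite -[X in measurable X]setTI; exact: measurable_rV_cons.
apply: measure_semi_sigma_additive.
- by move=> k; exact: mp.
- apply/trivIsetP => /= i j _ _ ij; rewrite -preimage_setI.
  by move/trivIsetP : tF => /(_ _ _ _ _ ij) ->//; rewrite preimage_set0.
- by rewrite -preimage_bigcup; exact: mp.
Qed.

HB.instance Definition _ := isMeasure.Build _ _ _ lebesgue_cons
  lebesgue_cons0 lebesgue_cons_ge0 lebesgue_cons_sigma_additive.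

Let lebesgue_cons_sigma_finite : sigma_finite setT lebesgue_cons.
Proof.
have /sigma_finiteP[F [TF ndF Foo]] := sigma_finiteT (@lebesgue_measure R).
have /sigma_finiteP[G [TG ndG Goo]] := sigma_finiteT mu.
exists (fun k => rV_split @^-1` (F k `*` G k)).
  rewrite -preimage_bigcup; apply/esym/seteqP; split => // x _.
  have [i _ Fi] : (\bigcup_i F i) (rV_split x).1 by rewrite -TF.
  have [j _ Gj] : (\bigcup_i G i) (rV_split x).2 by rewrite -TG.
  exists (maxn i j) => //; split => /=.
    by move: Fi; exact/subsetPset/ndF/leq_maxl.
  by move: Gj; exact/subsetPset/ndG/leq_maxr.
move=> k; have [mFk Fk] := Foo k; have [mGk Gk] := Goo k; split.
  rewrite -[X in measurable X]setTI; apply: measurable_rV_split => //.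
  exact: measurableX.
rewrite /lebesgue_cons /pushforward -comp_preimage.
rewrite (_ : _ \o _ = idfun); last by apply/funext => x /=; rewrite rV_consK.
by rewrite product_measure1E// lte_mul_pinfty// ge0_fin_numE.
Qed.

HB.instance Definition _ := Measure_isSigmaFinite.Build _ _ _ lebesgue_cons
  lebesgue_cons_sigma_finite.

End lebesgue_rV.

Fixpoint lebesgue_rV (R : realType) (n : nat) :
    {sigma_finite_measure set 'rV[R]_n -> \bar R} :=
  match n with
  | 0 => @dirac _ 'rV[R]_0 0 R
  | n'.+1 => lebesgue_cons (lebesgue_rV R n')
  end.

(* the measure 1_X w dm *)
Section density.
Local Open Scope ereal_scope.
Context d (T : measurableType d) (R : realType).
Variables (m : {measure set T -> \bar R}) (X : set T) (w : T -> R).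
Hypotheses (mX : measurable X) (mw : measurable_fun setT w).
Hypothesis w_ge0 : forall x, (0 <= w x)%R.

Definition density_measure of measurable X & measurable_fun setT w
    & (forall x, (0 <= w x)%R) : set T -> \bar R :=
  fun A => \int[m]_(x in A `&` X) (w x)%:E.

Local Notation dens := (density_measure mX mw w_ge0).

Let dens0 : dens set0 = 0.
Proof. by rewrite /density_measure set0I integral_set0. Qed.

Let dens_ge0 A : 0 <= dens A.
Proof. by apply: integral_ge0 => x _; rewrite lee_fin. Qed.

Let dens_sigma_additive : semi_sigma_additive dens.
Proof.
rewrite (_ : dens = fun A => \int[m]_(x in A) ((EFin \o w) \_ X) x); last first.
  by apply/funext => A; rewrite /density_measure integral_mkcondr.
apply: semi_sigma_additive_nng_induced.
  apply/(measurable_restrictT _ _).1 => //.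
  by apply: measurable_funTS; exact/measurable_EFinP.
by move=> x; apply: erestrict_ge0 => y _; rewrite lee_fin.
Qed.

HB.instance Definition _ := isMeasure.Build _ _ _ dens
  dens0 dens_ge0 dens_sigma_additive.

End density.

(* L^2(mu) as the library's square-integrable functions modulo a.e. equality,
   with real scalars *)
Section L2.
Local Open Scope quotient_scope.
Context d (T : measurableType d) (R : realType).
Variable mu : {measure set T -> \bar R}.

Let X := LfunType mu (lee1n 2).

Definition ae_null : {pred X} :=
  fun f => `[< ae_eq mu setT (f : T -> R) (cst 0) >].

Let ae_null_zmod_closed : zmod_closed ae_null.
Proof.
split; first exact/asboolP/ae_eq_refl.
move=> f g /asboolP f0 /asboolP g0; apply/asboolP.
have := ae_eq_sub f0 g0.
by apply: filterS => x fg xT; rewrite [LHS](fg xT)/= subr0.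
Qed.

HB.instance Definition _ := GRing.isZmodClosed.Build X ae_null ae_null_zmod_closed.

Definition L2 : Type := Quotient.quot ae_null.

HB.instance Definition _ := GRing.Zmodule.on L2.
HB.instance Definition _ := EqQuotient.on L2.

Definition L2_fun (x : L2) : T -> R := (repr x : X).

Lemma L2_eqP (f g : X) :
  reflect (ae_eq mu setT (f : T -> R) g) (\pi_L2 f == \pi_L2 g).
Proof.
rewrite eqmodE /= Quotient.equivE.
apply: (@iffP (ae_eq mu setT ((f - g : X) : T -> R) (cst 0))).
- exact: asboolP.
- by apply: filterS => x fg xT; apply/eqP; rewrite -subr_eq0; apply/eqP/fg.
- by apply: filterS => x fg xT; have /= fgx := fg xT; rewrite [LHS](_ : _ = f x - g x)// fgx subrr.
Qed.

Lemma repr_pi (f : X) : ae_eq mu setT (repr (\pi_L2 f) : T -> R) f.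
Proof. by apply/L2_eqP; rewrite reprK. Qed.

Definition L2_scale (a : R) (x : L2) : L2 := \pi_L2 (a *: (repr x : X)).

Lemma L2_scale_pi a (f : X) : L2_scale a (\pi_L2 f) = \pi_L2 (a *: f).
Proof.
apply/eqP/L2_eqP; have := repr_pi f.
apply: filterS => x fx xT.
by rewrite -[LHS]/(a * (repr (\pi_L2 f) : X) x) -[RHS]/(a * f x) fx.
Qed.

Lemma L2_piD (f g : X) : \pi_L2 f + \pi_L2 g = \pi_L2 (f + g).
Proof. by rewrite [RHS]raddfD. Qed.

Let L2_scaleA a b x : L2_scale a (L2_scale b x) = L2_scale (a * b) x.
Proof. elim/quotW: x => f. by rewrite (L2_scale_pi b f) !L2_scale_pi scalerA. Qed.

Let L2_scale1 : left_id 1 L2_scale.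
Proof. by elim/quotW=> f; rewrite L2_scale_pi scale1r. Qed.

Let L2_scaleDr : right_distributive L2_scale +%R.
Proof.
move=> a; elim/quotW=> f; elim/quotW=> g.
by rewrite L2_piD !L2_scale_pi L2_piD scalerDr.
Qed.

Let L2_scaleDl x : {morph L2_scale^~ x : a b / a + b}.
Proof.
by elim/quotW: x => f a b; rewrite !L2_scale_pi L2_piD scalerDl.
Qed.

HB.instance Definition _ := GRing.Zmodule_isLmodule.Build R L2
  L2_scaleA L2_scale1 L2_scaleDr L2_scaleDl.

Definition L2_norm (x : L2) : R := fine ('N[mu]_2[EFin \o L2_fun x])%E.

Lemma L2_norm_pi (f : X) : L2_norm (\pi_L2 f) = fine ('N[mu]_2[EFin \o f])%E.
Proof.
rewrite /L2_norm /L2_fun unlock; congr (fine (_ `^ _)%E).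
have mN (h : X) : measurable_fun setT (fun z => `|(EFin \o h) z| `^ 2)%E.
  apply: (measurableT_comp (measurable_poweR _)) => //.
  apply: measurableT_comp => //.
  by apply/measurable_EFinP.
apply: ae_eq_integral => //.
have := repr_pi f.
by apply: filterS => z fz zT /=; rewrite fz.
Qed.

Let L2_normD x y : L2_norm (x + y) <= L2_norm x + L2_norm y.
Proof.
elim/quotW: x => f; elim/quotW: y => g.
by rewrite L2_piD !L2_norm_pi; exact: ler_LnormD.
Qed.

Let L2_normZ a x : L2_norm (a *: x) = `|a| * L2_norm x.
Proof.
elim/quotW: x => f; rewrite [a *: _]L2_scale_pi !L2_norm_pi.
rewrite (_ : EFin \o _ = EFin \o (a \*: (f : T -> R)))//.
by rewrite LnormZ fineM// -finite_norm_fine.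
Qed.

Let L2_norm0_eq0 x : L2_norm x = 0 -> x = 0.
Proof.
elim/quotW: x => f; rewrite L2_norm_pi => /fine_Lnormr_eq0 f0.
rewrite -[0](raddf0 \pi_L2); apply/eqP/L2_eqP.
by apply: filterS f0 => z fz zT; exact: fz.
Qed.

HB.instance Definition _ := Lmodule_isNormed.Build R L2
  L2_normD L2_normZ L2_norm0_eq0.

Definition L2_mean (x : L2) : R := (\int[mu]_z L2_fun x z)%R.

Definition L2_class (x : L2) (f : T -> R) : Prop := ae_eq mu setT (L2_fun x) f.

Definition L2_dot (x y : L2) : R := (\int[mu]_z (L2_fun x z * L2_fun y z))%R.

End L2.

(* In finite dimension, existence and continuity of all iterated directional
   derivatives is the usual C^k regularity. *)
Fixpoint Ck (R : realType) (U : normedModType R) (k : nat) (f : U -> R) : Prop :=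
  match k with
  | 0 => continuous f
  | k'.+1 => continuous f /\
      forall v, (forall x, derivable f x v) /\ Ck k' (fun x => 'D_v f x)
  end.

Definition smooth (R : realType) (U : normedModType R) (f : U -> R) : Prop :=
  forall k, Ck k f.

(* The torus (aT)^D is handled through a-periodic functions on R^D and the
   fundamental cell [0, a)^D, which carries all the measures. *)
Variant position_space (R : realType) := Torus of R | Euclidean.
Arguments Euclidean {R}.
Arguments Torus {R}.

Section position_space.
Variables (R : realType) (D : nat).
Implicit Types (E : position_space R) (q : 'rV[R]_D).

Definition cell E : set 'rV[R]_D :=
  if E is Torus a then [set q | forall i, 0 <= q ord0 i < a] else setT.

Definition periodic E (f : 'rV[R]_D -> R) : Prop :=
  if E is Torus a then forall q i, f (q + a *: delta_mx ord0 i) = f q else True.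

(* q lies outside the ball of radius r; void on the compact torus *)
Definition beyond E (r : R) q : bool := if E is Euclidean then r < `|q| else false.

Lemma measurable_cell E : measurable (cell E).
Proof.
case: E => [a|]; last exact: measurableT.
have -> : cell (Torus a) = \big[setI/setT]_(i < D)
    ((fun q : 'rV[R]_D => q ord0 i) @^-1` `[0, a[).
  rewrite -bigcap_seq; apply/seteqP; split => [q qa i _|q qa i].
    by rewrite /= in_itv/=; exact: qa.
  by have := qa i; rewrite /= mem_index_enum in_itv/=; exact.
elim/big_ind : _ => [||i _];
  [exact: measurableT|by move=> A1 A2 m1 m2; apply: measurableI|].
by rewrite -[X in measurable X]setTI; apply: measurable_coord.
Qed.

End position_space.

Record langevin_system (R : realType) (D : nat) := LangevinSystem {
  position : position_space R;
  beta : R;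
  mass : R;
  potential : 'rV[R]_D -> R;
  period_gt0 : if position is Torus a then 0 < a else true;
  beta_gt0 : 0 < beta;
  mass_gt0 : 0 < mass;
  potential_smooth : smooth potential;
  potential_periodic : periodic position potential;
  potential_integrable : (lebesgue_rV R D).-integrable (cell position)
    (fun q => (expR (- beta * potential q))%:E)
}.

Section measures.
Variables (R : realType) (D : nat) (S : langevin_system R D).
Local Notation phase := ('rV[R]_D * 'rV[R]_D)%type.

Definition kinetic (p : 'rV[R]_D) : R :=
  (\sum_(i < D) p ord0 i ^+ 2) / (2 * mass S).

Definition position_Z : R :=
  fine (\int[lebesgue_rV R D]_(q in cell (position S))
    (expR (- beta S * potential S q))%:E)%E.

Definition position_density (q : 'rV[R]_D) : R :=
  position_Z^-1 * expR (- beta S * potential S q).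

Definition maxwell_density (p : 'rV[R]_D) : R :=
  (beta S / (2 * pi * mass S)) `^ (D%:R / 2) * expR (- beta S * kinetic p).

Definition phase_lebesgue : {measure set phase -> \bar R} :=
  (lebesgue_rV R D \x lebesgue_rV R D)%E.

Definition phase_cell : set phase := cell (position S) `*` setT.

Definition phase_Z : R :=
  fine (\int[phase_lebesgue]_(z in phase_cell)
    (expR (- beta S * (potential S z.1 + kinetic z.2)))%:E)%E.

Definition gibbs_density (z : phase) : R :=
  phase_Z^-1 * expR (- beta S * (potential S z.1 + kinetic z.2)).

Let measurable_potential :
  measurable_fun setT (potential S : 'rV[R]_D -> measurableTypeR R).
Proof. exact: continuous_measurable_rV (potential_smooth S 0%N). Qed.

Let measurable_kinetic :
  measurable_fun setT (kinetic : 'rV[R]_D -> measurableTypeR R).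
Proof.
apply: measurable_funM => //; apply: measurable_sum => i.
by apply: measurable_funX; exact: measurable_coord.
Qed.

Lemma measurable_position_density : measurable_fun setT position_density.
Proof.
apply: measurable_funM => //; apply: measurableT_comp => //.
exact: measurable_funM.
Qed.

Lemma position_density_ge0 q : 0 <= position_density q.
Proof.
rewrite mulr_ge0 ?expR_ge0// invr_ge0 fine_ge0// integral_ge0// => ? _.
Qed.

Lemma measurable_maxwell_density : measurable_fun setT maxwell_density.
Proof.
apply: measurable_funM => //; apply: measurableT_comp => //.
exact: measurable_funM.
Qed.

Lemma maxwell_density_ge0 p : 0 <= maxwell_density p.
Proof. by rewrite mulr_ge0 ?expR_ge0// powR_ge0. Qed.

Lemma measurable_gibbs_density : measurable_fun setT gibbs_density.
Proof.
apply: measurable_funM => //; apply: measurableT_comp => //.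
apply: measurable_funM => //; apply: measurable_funD.
  exact: (measurableT_comp measurable_potential).
exact: (measurableT_comp measurable_kinetic).
Qed.

Lemma gibbs_density_ge0 z : 0 <= gibbs_density z.
Proof.
rewrite mulr_ge0 ?expR_ge0// invr_ge0 fine_ge0// integral_ge0// => ? _.
Qed.

Lemma measurable_phase_cell : measurable phase_cell.
Proof. by apply: measurableX => //; exact: measurable_cell. Qed.

Definition position_gibbs : {measure set 'rV[R]_D -> \bar R} :=
  density_measure (lebesgue_rV R D) (measurable_cell (position S))
    measurable_position_density position_density_ge0.

Definition maxwell : {measure set 'rV[R]_D -> \bar R} :=
  density_measure (lebesgue_rV R D) (@measurableT _ 'rV[R]_D)
    measurable_maxwell_density maxwell_density_ge0.

Definition gibbs : {measure set phase -> \bar R} :=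
  density_measure phase_lebesgue measurable_phase_cell
    measurable_gibbs_density gibbs_density_ge0.

End measures.

(* Possibly unbounded operators are given by their graphs. *)
Section operators.
Context d (T : measurableType d) (R : realType).
Variable m : {measure set T -> \bar R}.
Local Notation H := (L2 m).
Implicit Types (G : H -> H -> Prop) (Q B : H -> H) (W : set H).

Definition op_closure G (x y : H) : Prop :=
  exists u v : nat -> H, [/\ forall n, G (u n) (v n),
    u n @[n --> \oo] --> x & v n @[n --> \oo] --> y].

Definition op_adjoint G (x y : H) : Prop :=
  forall u v, G u v -> L2_dot v x = L2_dot u y.

Definition is_adjoint Q Qstar : Prop :=
  forall x y : H, L2_dot (Q x) y = L2_dot x (Qstar y).

Definition finite_dimensional W : Prop :=
  exists n (b : 'I_n -> H),
    W = [set x | exists c : 'I_n -> R, x = \sum_(i < n) c i *: b i].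

Definition orthogonal_projector W Q : Prop :=
  forall x, W (Q x) /\ forall y, W y -> L2_dot (x - Q x) y = 0.

Definition opnorm W Q : \bar R :=
  ereal_sup [set (`|Q x|)%:E | x in W `&` [set x | `|x| <= 1]].

Definition op_exp B (x : H) : H :=
  limn (fun n => \sum_(0 <= k < n) k`!%:R^-1 *: iter k B x).

Definition inverse_on W B Q : Prop :=
  forall x, W x -> [/\ W (B x), W (Q x), Q (B x) = x & B (Q x) = x].

(* Q is the integral over [0, +oo) of the B(W)-valued function F, W finite
   dimensional: the integral is taken coefficient by coefficient. *)
Definition is_integral_on W (F : R -> H -> H) Q : Prop :=
  (forall x, W x -> W (Q x)) /\
  forall x y, W x -> W y ->
    (@lebesgue_measure R).-integrable `[0, +oo[
      (fun t => (L2_dot (F t x) y)%:E) /\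
    L2_dot (Q x) y = (\int[lebesgue_measure]_(t in `[0, +oo[) L2_dot (F t x) y)%R.

End operators.

Section langevin.
Variables (R : realType) (D : nat) (S : langevin_system R D).
Local Notation phase := ('rV[R]_D * 'rV[R]_D)%type.
Local Notation H := (L2 (gibbs S)).
Local Notation V := (potential S).

Definition basis (i : 'I_D) : 'rV[R]_D := delta_mx ord0 i.

Definition dx (i : 'I_D) (f : 'rV[R]_D -> R) (q : 'rV[R]_D) : R :=
  'D_(basis i) f q.

Definition dq (i : 'I_D) (f : phase -> R) (z : phase) : R :=
  'D_((basis i, 0) : phase) f z.

Definition dp (i : 'I_D) (f : phase -> R) (z : phase) : R :=
  'D_((0, basis i) : phase) f z.

(* C_c^oo of the position space, resp. of the phase space *)
Definition test_position (f : 'rV[R]_D -> R) : Prop :=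
  [/\ smooth f, periodic (position S) f &
      exists r, forall q, beyond (position S) r q -> f q = 0].

Definition test_phase (f : phase -> R) : Prop :=
  [/\ smooth f, forall p, periodic (position S) (fun q => f (q, p)) &
      exists r, forall q p, beyond (position S) r q || (r < `|p|) -> f (q, p) = 0].

(* g is the weak gradient of x; x is in H^1(nu) iff such a g exists. *)
Definition weak_gradient (x : L2 (position_gibbs S))
    (g : 'I_D -> L2 (position_gibbs S)) : Prop :=
  forall i f, test_position f ->
    (\int[lebesgue_rV R D]_(q in cell (position S)) (L2_fun x q * dx i f q) =
     - \int[lebesgue_rV R D]_(q in cell (position S)) (L2_fun (g i) q * f q))%R.

Definition poincare : Prop :=
  exists2 C, 0 < C & forall x g, weak_gradient x g ->
    (\int[position_gibbs S]_q (L2_fun x q - L2_mean x) ^+ 2)%R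
      <= C^-1 * \sum_(i < D) `|g i| ^+ 2.

Definition grad_norm (q : 'rV[R]_D) : R :=
  Num.sqrt (\sum_(i < D) dx i V q ^+ 2).

Definition hessian_norm (q : 'rV[R]_D) : R :=
  Num.sqrt (\sum_(i < D) \sum_(j < D) dx i (dx j V) q ^+ 2).

Definition laplacian (q : 'rV[R]_D) : R := \sum_(i < D) dx i (dx i V) q.

Definition potential_growth : Prop :=
  exists c1 c2 c3 : R, [/\ 0 < c1, 0 <= c2 < 1, 0 < c3 & forall q,
    laplacian q <= c1 + c2 / 2 * grad_norm q ^+ 2 /\
    hessian_norm q <= c3 * (1 + grad_norm q)].

Definition potential_assumption : Prop := poincare /\ potential_growth.

Definition L_ham (f : phase -> R) (z : phase) : R :=
  \sum_(i < D) (z.2 ord0 i / mass S * dq i f z - dx i V z.1 * dp i f z).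

Definition L_FD (f : phase -> R) (z : phase) : R :=
  \sum_(i < D) (- (z.2 ord0 i / mass S * dp i f z)
                + (beta S)^-1 * dp i (dp i f) z).

Definition L_langevin (gamma : R) (f : phase -> R) (z : phase) : R :=
  L_ham f z + gamma * L_FD f z.

Definition on_test (Lop : (phase -> R) -> phase -> R) (x y : H) : Prop :=
  exists f, [/\ test_phase f, L2_class x f & L2_class y (Lop f)].

(* C_c^oo is a core of the generator of the Langevin dynamics. *)
Definition is_generator (gamma : R) (dom : set H) (L : H -> H) : Prop :=
  forall x y, op_closure (on_test (L_langevin gamma)) x y <-> dom x /\ L x = y.

Definition Pi_p (x y : H) : Prop :=
  L2_class y (fun z => \int[maxwell S]_p L2_fun x (z.1, p))%R.

Definition L_ham_Pi_p (x y : H) : Prop :=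
  exists2 g, Pi_p x g & op_closure (on_test L_ham) g y.

(* u = (1 + T^* T)^{-1} T^* x with T = L_ham Pi_p, for x in the domain of T^* *)
Definition A_formula (x u : H) : Prop :=
  exists v w y, [/\ L_ham_Pi_p u v, op_adjoint L_ham_Pi_p v w,
    op_adjoint L_ham_Pi_p x y & u + w = y].

(* A_formula is densely defined; its closure is the everywhere defined bounded
   operator A. *)
Definition is_operator_A (A : H -> H) : Prop :=
  forall x y, op_closure A_formula x y <-> A x = y.

Definition gamma_min (gamma : R) : R := Num.min gamma gamma^-1.

Definition rate (eps_bar : R) (lambda_tilde : R -> R) (gamma : R) : R :=
  lambda_tilde gamma / (1 + eps_bar * gamma_min gamma).

(* [f - \int f dmu] ranges over Pi_0 C_c^oo. *)
Definition hypocoercive (A : H -> H) (eps_bar lambda_bar : R)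
    (lambda_tilde : R -> R) : Prop :=
  [/\ 0 < eps_bar < 1, 0 < lambda_bar & forall gamma, 0 < gamma ->
    [/\ 0 < lambda_tilde gamma,
        lambda_bar * gamma_min gamma <= rate eps_bar lambda_tilde gamma &
        forall f (x y : H), test_phase f ->
          let f0 := fun z => f z - (\int[gibbs S]_w f w)%R in
          L2_class x f0 -> L2_class y (L_langevin gamma f0) ->
          let eps := eps_bar * gamma_min gamma in
          lambda_tilde gamma * `|x| ^+ 2 <=
            L2_dot (- y) x + eps * L2_dot (A y) x + eps * L2_dot (A x) y]].

End langevin.

(* Main.v *)
Require Import Defs.
From HB Require Import structures.
From mathcomp Require Import all_boot all_order all_algebra.
From mathcomp Require Import ring lra.
From mathcomp Require Import all_classical all_reals all_analysis measurable_realfun.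
Set Implicit Arguments.
Unset Strict Implicit.
Unset Printing Implicit Defensive.
Import Order.TTheory GRing.Theory Num.Theory.
Import numFieldNormedType.Exports.
Local Open Scope classical_set_scope.
Local Open Scope ring_scope.

(* Put h(x) = |x|^2 / 2 - eps <A x, x>. Since |A| <= 1/2, h lies between
   (1 - eps) |x|^2 / 2 and (1 + eps) |x|^2 / 2. The hypocoercive inequality
   extends by density from the core to V_M, and replacing L by
   L_M = P_M L P_M costs at most eps delta_M |x|^2 there, where delta_M is the
   norm assumed to tend to 0. With
   lambda_M = (lambda_tilde - eps delta_M) / (1 + eps), the derivative of h
   along the Galerkin flow is at most - 2 lambda_M h, so Gronwall's lemma gives
   exponential decay with C = sqrt ((1 + eps_bar) / (1 - eps_bar)). The same
   inequality makes L_M injective on V_M, and integrating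
   d/dt exp(t L_M) L_M^-1 x = exp(t L_M) x over [0, +oo[ gives the formula for
   the inverse. *)

(** * Inner product of L^2 *)

Section L2_inner_product.
Local Open Scope quotient_scope.
Context d (T : measurableType d) (R : realType) (m : {measure set T -> \bar R}).
Local Notation H := (L2 m).
Local Notation X := (LfunType m (lee1n 2)).
Implicit Types x y : H.

Lemma measurable_L2_fun x : measurable_fun setT (L2_fun x).
Proof. by rewrite /L2_fun. Qed.

Lemma L2_fun_Lfun x : L2_fun x \in Lfun m 2%:E.
Proof. exact: LfunP. Qed.

Lemma L2_funD x y : ae_eq m setT (L2_fun (x + y)) (L2_fun x \+ L2_fun y).
Proof.
rewrite -[x in L2_fun (x + y)]reprK -[y in L2_fun (_ + y)]reprK L2_piD.
exact: repr_pi.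
Qed.

Lemma L2_funZ a x : ae_eq m setT (L2_fun (a *: x)) (fun t => a * L2_fun x t).
Proof.
exact: (repr_pi (a *: (repr x : X))).
Qed.

Lemma L2_class_pi (f : X) : L2_class (\pi_(H) f) (f : T -> R).
Proof. exact: repr_pi. Qed.

Lemma integrable_L2_mul x y :
  m.-integrable setT (EFin \o (fun z => L2_fun x z * L2_fun y z)).
Proof.
by apply/Lfun1_integrable; apply: Lfun2_mul_Lfun1; exact: L2_fun_Lfun.
Qed.

Lemma ae_eq_Rintegral (f g : T -> R) : measurable_fun setT f ->
  measurable_fun setT g -> ae_eq m setT f g ->
  (\int[m]_z f z = \int[m]_z g z)%R.
Proof.
move=> mf mg fg; congr fine; apply: ae_eq_integral => //.
- exact/measurable_EFinP.
- exact/measurable_EFinP.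
- by apply: filterS fg => z fg ?; rewrite fg.
Qed.

Lemma L2_dotC x y : L2_dot x y = L2_dot y x.
Proof. by apply: eq_Rintegral => z _; rewrite mulrC. Qed.

Lemma L2_dotDl x y z : L2_dot (x + y) z = L2_dot x z + L2_dot y z.
Proof.
rewrite /L2_dot -RintegralD//; [|exact: integrable_L2_mul..].
apply: ae_eq_Rintegral.
- by apply: measurable_funM; exact: measurable_L2_fun.
- by apply: measurable_funD; apply: measurable_funM; exact: measurable_L2_fun.
- by apply: filterS (L2_funD x y) => t + _ => ->//=; rewrite mulrDl.
Qed.

Lemma L2_dotZl a x y : L2_dot (a *: x) y = a * L2_dot x y.
Proof.
rewrite /L2_dot -RintegralZl//; last exact: integrable_L2_mul.
apply: ae_eq_Rintegral.
- by apply: measurable_funM; exact: measurable_L2_fun.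
- apply: measurable_funM => //.
  by apply: measurable_funM; exact: measurable_L2_fun.
- by apply: filterS (L2_funZ a x) => t + _ => ->//=; rewrite mulrA.
Qed.

Lemma L2_dotDr x y z : L2_dot x (y + z) = L2_dot x y + L2_dot x z.
Proof. by rewrite ![L2_dot x _]L2_dotC L2_dotDl. Qed.

Lemma L2_dotZr a x y : L2_dot x (a *: y) = a * L2_dot x y.
Proof. by rewrite ![L2_dot x _]L2_dotC L2_dotZl. Qed.

Lemma L2_dotNl x y : L2_dot (- x) y = - L2_dot x y.
Proof. by rewrite -scaleN1r L2_dotZl mulN1r. Qed.

Lemma L2_dotNr x y : L2_dot x (- y) = - L2_dot x y.
Proof. by rewrite L2_dotC L2_dotNl L2_dotC. Qed.

Lemma L2_dotBl x y z : L2_dot (x - y) z = L2_dot x z - L2_dot y z.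
Proof. by rewrite L2_dotDl L2_dotNl. Qed.

Lemma L2_dotBr x y z : L2_dot z (x - y) = L2_dot z x - L2_dot z y.
Proof. by rewrite L2_dotDr L2_dotNr. Qed.

Lemma L2_dot0l x : L2_dot 0 x = 0.
Proof. by rewrite -(scale0r 0) L2_dotZl mul0r. Qed.

(** The norm is the real part of an extended-real $L^2$ norm; raising that norm to the power 2
    removes the root and leaves the integral of $|x|^2$. *)
Lemma L2_dotxx x : L2_dot x x = `|x| ^+ 2.
Proof.
rewrite -[`|x|]/(fine ('N[m]_2[EFin \o L2_fun x])%E).
have := powR_Lnorm m (EFin \o L2_fun x) (_ : 2 != 0 :> R); rewrite pnatr_eq0.
move=> /(_ isT) => /(congr1 fine); rewrite fine_poweR powR_mulrn; last first.
  by rewrite fine_ge0// Lnorm_ge0.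
move=> ->; congr fine; apply: eq_integral => t _ /=.
by rewrite -[RHS]/(`|L2_fun x t| `^ 2)%:E powR_mulrn// real_normK ?num_real// expr2.
Qed.

Lemma L2_dot_ge0 x : 0 <= L2_dot x x.
Proof. by rewrite L2_dotxx sqr_ge0. Qed.

Lemma L2_cauchy_schwarz x y : `|L2_dot x y| <= `|x| * `|y|.
Proof.
have [->|x0] := eqVneq x 0; first by rewrite L2_dot0l !normr0 mul0r.
have nx : 0 < `|x| by rewrite normr_gt0.
(* This vector has squared norm $|x|^2 (|x|^2 |y|^2 - \langle x, y\rangle^2)$, so positivity gives
   the claim after cancelling $|x|^2$. *)
have := L2_dot_ge0 (L2_dot x y *: x - `|x| ^+ 2 *: y).
rewrite L2_dotBl !L2_dotBr !L2_dotZl !L2_dotZr (L2_dotC y x) !L2_dotxx => h.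
rewrite -ler_sqr ?nnegrE ?mulr_ge0// real_normK ?num_real// exprMn.
rewrite -(ler_pM2l (exprn_gt0 2 nx)); nra.
Qed.

Lemma L2_dot_le x y : L2_dot x y <= `|x| * `|y|.
Proof. exact: le_trans (ler_norm _) (L2_cauchy_schwarz _ _). Qed.

Lemma cvg_L2_dot (F : set_system nat) {FF : Filter F} (u v : nat -> H) x y :
  u n @[n --> F] --> x -> v n @[n --> F] --> y ->
  L2_dot (u n) (v n) @[n --> F] --> L2_dot x y.
Proof.
move=> ux vy.
(* Expanding around the limits leaves three error terms, each with a factor tending to 0;
   Cauchy-Schwarz bounds them all. *)
have -> : (fun n => L2_dot (u n) (v n)) = (fun n =>
    L2_dot (u n - x) (v n - y) + (L2_dot x (v n - y) + L2_dot (u n - x) y) +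
    L2_dot x y).
  apply/funext => n; rewrite !L2_dotBl !L2_dotBr; ring.
have u0 : `|u n - x| @[n --> F] --> 0.
  by rewrite -(normr0 H); apply: cvg_norm; rewrite -(subrr x);
    apply: cvgB => //; exact: cvg_cst.
have v0 : `|v n - y| @[n --> F] --> 0.
  by rewrite -(normr0 H); apply: cvg_norm; rewrite -(subrr y);
    apply: cvgB => //; exact: cvg_cst.
rewrite -[X in _ --> X]add0r; apply: cvgD; last exact: cvg_cst.
have sq (f g : nat -> R) : (forall n, `|f n| <= g n) ->
    g n @[n --> F] --> 0 -> f n @[n --> F] --> 0.
  move=> fg g0; apply: (@squeeze_cvgr _ _ _ _ (fun n => - g n) g) => //.
    by near=> n; rewrite -ler_norml.
  by rewrite -oppr0; exact: cvgN.
rewrite -[X in _ --> X]add0r; apply: cvgD;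
  last (rewrite -[X in _ --> X]add0r; apply: cvgD).
- apply: sq => [n|]; first exact: L2_cauchy_schwarz.
  by rewrite -(mul0r 0); exact: cvgM.
- apply: sq => [n|]; first exact: L2_cauchy_schwarz.
  by rewrite -(mulr0 `|x|); apply: cvgM => //; exact: cvg_cst.
- apply: sq => [n|]; first exact: L2_cauchy_schwarz.
  by rewrite -(mul0r `|y|); apply: cvgM => //; exact: cvg_cst.
Unshelve. all: end_near. Qed.

Lemma L2_dot_inj x y : (forall z, L2_dot x z = L2_dot y z) -> x = y.
Proof.
move=> xy; apply/eqP; rewrite -subr_eq0 -normr_eq0 -sqrf_eq0 -L2_dotxx.
by rewrite L2_dotBl xy subrr.
Qed.

(** Having an adjoint forces linearity, because $\langle Qx, z\rangle = \langle x, Q^* z\rangle$ is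
    linear in $x$ for every $z$. This is where the linearity of [A] comes from. *)
Lemma is_adjoint_linear (Q Qstar : H -> H) : is_adjoint Q Qstar -> linear Q.
Proof.
move=> QQ a x y; apply: L2_dot_inj => z.
by rewrite QQ !L2_dotDl !L2_dotZl !QQ.
Qed.

Lemma is_adjoint_sym (Q Qstar : H -> H) : is_adjoint Q Qstar -> is_adjoint Qstar Q.
Proof. by move=> QQ x y; rewrite L2_dotC -QQ L2_dotC. Qed.

Lemma orthogonal_projector_id (W : set H) (P : H -> H) x :
  (forall x y, W x -> W y -> W (x - y)) ->
  orthogonal_projector W P -> W x -> P x = x.
Proof.
move=> WB PP Wx; have [WPx /(_ (x - P x))] := PP x.
by rewrite L2_dotxx => /(_ (WB _ _ Wx WPx))/eqP;
  rewrite sqrf_eq0 normr_eq0 subr_eq0 eq_sym => /eqP.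
Qed.

(** The defect of linearity lies in [W], and it is also a combination of residuals $x - Px$, which
    are orthogonal to [W]; so it is orthogonal to itself. *)
Lemma orthogonal_projector_linear (W : set H) (P : H -> H) :
  (forall a x y, W x -> W y -> W (a *: x + y)) ->
  orthogonal_projector W P -> linear P.
Proof.
move=> WD PP a x y.
have WB u v : W u -> W v -> W (u - v).
  by move=> Wu Wv; rewrite addrC -scaleN1r; exact: WD.
have [Wx ox] := PP x; have [Wy oy] := PP y; have [Wz oz] := PP (a *: x + y).
apply/eqP; rewrite -subr_eq0 -normr_eq0 -sqrf_eq0 -L2_dotxx; apply/eqP.
set w := _ - _; have Ww : W w by apply: WB => //; exact: WD.
have {1}-> : w = a *: (x - P x) + (y - P y) - (a *: x + y - P (a *: x + y)).
  by rewrite scalerBr /w [in RHS]addrACA -[- (a *: P x) - P y]opprD opprB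
    [RHS]addrC addrA subrK.
by rewrite L2_dotBl L2_dotDl L2_dotZl ox// oy// oz// mulr0 addr0 subr0.
Qed.

End L2_inner_product.

(** * The operator A *)

Section operator_A_bound.
Context (R : realType) (D : nat) (S : langevin_system R D).
Local Notation H := (L2 (gibbs S)).

(* Pairing u + T^*T u = T^* x with u gives |u|^2 + |T u|^2 = <T u, x>, whence
   |u|^2 <= |T u| (|x| - |T u|) <= |x|^2 / 4. *)
Lemma A_formula_le (x u : H) : A_formula x u -> `|u| <= `|x| / 2.
Proof.
move=> [v [w [y [uv vw xy uwy]]]].
have := xy _ _ uv; have := vw _ _ uv; rewrite -uwy L2_dotDr !L2_dotxx => <- h.
have := L2_dot_le v x; rewrite h => {}h.
have := sqr_ge0 (`|x| / 2 - `|v|) => h'.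
rewrite -ler_sqr ?nnegrE ?divr_ge0//.
nra.
Qed.

(** The graph of [A] is the closure of [A_formula], so the bound passes to the limit along an
    approximating sequence. *)
Lemma operator_A_le (A : H -> H) x : is_operator_A A -> `|A x| <= `|x| / 2.
Proof.
move=> hA; have [u [v [uv ux vA]]] := (hA x (A x)).2 erefl.
apply: (@ler_cvg_to _ \oo _ _ (fun n => `|v n|) (fun n => `|u n| / 2)).
- exact: cvg_norm.
- by apply: cvgM; [exact: cvg_norm|exact: cvg_cst].
- by near=> n; exact: A_formula_le.
Unshelve. all: end_near. Qed.

End operator_A_bound.

Lemma linear_bounded_cvg (R : realType) (U V : normedModType R) (A : U -> V)
    (k : R) (u : nat -> U) (x : U) :
  linear A -> (forall y, `|A y| <= k * `|y|) ->
  u n @[n --> \oo] --> x -> A (u n) @[n --> \oo] --> A x.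
Proof.
move=> lA kA ux.
have AB y z : A (y - z) = A y - A z.
  by rewrite addrC -scaleN1r lA scaleN1r addrC.
have u0 : k * `|u n - x| @[n --> \oo] --> 0.
  rewrite -(mulr0 k) -(normr0 U) -(subrr x); apply: cvgM; first exact: cvg_cst.
  by apply: cvg_norm; apply: cvgB => //; exact: cvg_cst.
apply/cvgrPdist_lt => e e0; near=> n.
rewrite distrC -AB (le_lt_trans (kA _))//.
rewrite (le_lt_trans (ler_norm _))//.
near: n; have /cvgr0_norm_lt := u0; exact.
Unshelve. all: end_near. Qed.

(** * Constants in $L^2$ and the mean *)

Section finite_measure_class.
Context d (T : measurableType d) (R : realType) (m : {measure set T -> \bar R}).
Hypothesis m_fin : (m setT < +oo)%E.

Lemma exists_L2_one : exists e : L2 m, L2_class e (cst 1).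
Proof.
have one_in : (cst 1 : T -> R) \in Lfun m 2%:E.
  rewrite inE/=; apply/andP; split; rewrite inE//=.
  rewrite /finite_norm unlock poweR_lty//.
  under eq_integral => x _ /= do rewrite normr1 powR1.
  by rewrite integral_cst// mul1e.
exists (\pi_(L2 m) (Lfun_Sub (lee1n 2) one_in))%qT.
exact: L2_class_pi.
Qed.

End finite_measure_class.

Section mean.
Context d (T : measurableType d) (R : realType) (m : {measure set T -> \bar R}).
Variables (e : L2 m) (e1 : L2_class e (cst 1)).
Implicit Type x : L2 m.

(** As an inner product with the class of 1, the mean becomes linear and continuous in $L^2$. *)
Lemma L2_meanE x : L2_mean x = L2_dot x e.
Proof.
apply: ae_eq_Rintegral.
- by apply: measurable_L2_fun.
- by apply: measurable_funM; exact: measurable_L2_fun.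
- by apply: filterS e1 => t et ?; rewrite et// mulr1.
Qed.

Lemma L2_class_sub_cst x f c :
  L2_class x f -> L2_class (x - c *: e) (fun z => f z - c).
Proof.
move=> xf; rewrite /L2_class -scaleNr.
apply: filterS (filterI (L2_funD x (- c *: e))
  (filterI xf (filterI (L2_funZ (- c) e) e1))).
move=> t [Dt [ft [Zt et]]] I1.
by rewrite Dt//= ft// Zt// et// mulr1.
Qed.

Lemma L2_class_mean x f : measurable_fun setT f -> L2_class x f ->
  (\int[m]_z f z)%R = L2_dot x e.
Proof.
move=> mf xf; rewrite -L2_meanE; apply/esym/ae_eq_Rintegral => //.
Qed.

End mean.

(** * Linear combinations of smooth functions *)

Section smooth.
Context (R : realType) (U : normedModType R).
Implicit Types f g : U -> R.

Lemma smooth_continuous f : smooth f -> continuous f.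
Proof. by move=> /(_ 0%N). Qed.

Lemma smooth_derivable f x v : smooth f -> derivable f x v.
Proof. by move=> /(_ 1%N)[_ /(_ v)[]]. Qed.

Lemma smooth_derive f v : smooth f -> smooth (fun x => 'D_v f x).
Proof. by move=> sf k; have [_ /(_ v)[]] := sf k.+1. Qed.

Lemma derive_linear f g a x v : derivable f x v -> derivable g x v ->
  'D_v (fun y => a * f y + g y) x = a * 'D_v f x + 'D_v g x.
Proof.
move=> df dg; rewrite -[LHS]/('D_v (a *: f + g) x).
by rewrite (deriveD (derivableZ df) dg) (deriveZ _ df).
Qed.

Lemma Ck_linear k f g a : Ck k f -> Ck k g -> Ck k (fun y => a * f y + g y).
Proof.
have cfg (h1 h2 : U -> R) : continuous h1 -> continuous h2 ->
    continuous (fun y => a * h1 y + h2 y).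
  move=> c1 c2 x; apply: cvgD; last exact: c2.
  by apply: cvgM; [exact: cvg_cst|exact: c1].
elim: k f g => [|k IH] f g /=; first exact: cfg.
move=> [cf df] [cg dg]; split; first exact: cfg.
move=> v; have [dfv Cf] := df v; have [dgv Cg] := dg v; split.
  by move=> x; apply: derivableD => //; exact: derivableZ.
rewrite (_ : (fun x => _) = fun x => a * 'D_v f x + 'D_v g x); first exact: IH.
by apply/funext => x; rewrite derive_linear.
Qed.

Lemma smooth_linear f g a : smooth f -> smooth g -> smooth (fun y => a * f y + g y).
Proof. by move=> sf sg k; exact: Ck_linear. Qed.

Lemma derive_sub_cst f c v :
  smooth f -> 'D_v (fun y => f y - c) = 'D_v f.
Proof.
move=> sf; apply/funext => x.
rewrite -[LHS]/('D_v (f - cst c) x) deriveB//; first by rewrite derive_cst subr0.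
exact: smooth_derivable.
Qed.

End smooth.

(** * The Langevin generator on mean-zero functions *)

(** Phase space carries the product sigma-algebra. Gluing the two blocks into one row of length
    [D + D] reduces the claim to continuous functions of a single row vector. *)
Lemma continuous_measurable_phase (R : realType) (D : nat)
    (f : 'rV[R]_D * 'rV[R]_D -> R) : continuous f -> measurable_fun setT f.
Proof.
move=> cf; pose g (x : 'rV[R]_(D + D)) := f (lsubmx x, rsubmx x).
have ch : continuous (fun y : 'rV[R]_(D + D) => (lsubmx y, rsubmx y)).
  move=> x U /nbhs_ballP[e e0 xU].
  apply: filterS (nbhsx_ballx x e e0) => y [_ xy]; apply: xU.
  by split; split => // i j; rewrite !mxE; exact: xy.
have cg : continuous g by move=> x; exact: (cvg_comp _ f (ch x) (cf _)).
have -> : f = g \o (fun z => row_mx z.1 z.2).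
  by apply/funext => -[q p]; rewrite /g /= row_mxKl row_mxKr.
apply: measurableT_comp; first exact: continuous_measurable_rV.
apply: measurable_fun_rV => i.
rewrite (_ : (fun _ => _) = fun z : 'rV[R]_D * 'rV[R]_D =>
  match fintype.split i with inl j => z.1 ord0 j | inr j => z.2 ord0 j end); last first.
  by apply/funext => z; rewrite mxE.
case: (fintype.split i) => j.
  exact: (measurableT_comp (measurable_coord j)).
exact: (measurableT_comp (measurable_coord j)).
Qed.

Section generator.
Context (R : realType) (D : nat) (S : langevin_system R D).
Local Notation phase := ('rV[R]_D * 'rV[R]_D)%type.
Local Notation H := (L2 (gibbs S)).

(* The total mass is Z / Z, which is 0 when Z is infinite, since then
   [fine] yields the normalization 0^-1 = 0. *)
Lemma gibbs_finite : (gibbs S setT < +oo)%E.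
Proof.
rewrite [gibbs S setT](_ : _ = \int[phase_lebesgue R D]_(z in phase_cell S)
  (gibbs_density S z)%:E)%E; last by rewrite -[in RHS](setTI (phase_cell S)).
have [Z0|Z0] := eqVneq (phase_Z S) 0.
  by rewrite integral0_eq// => z _; rewrite /gibbs_density Z0 invr0 mul0r.
have mw : measurable_fun (phase_cell S)
    (fun z => expR (- beta S * (potential S z.1 + kinetic S z.2))).
  rewrite (_ : (fun _ => _) = fun z => phase_Z S * gibbs_density S z).
    by apply: measurable_funM => //; apply: measurable_funTS;
      exact: measurable_gibbs_density.
  by apply/funext => z; rewrite /gibbs_density mulVKf.
rewrite /gibbs_density; under eq_integral do rewrite EFinM.
rewrite ge0_integralZl_EFin.
- move: Z0; rewrite /phase_Z; move: (integral _ _ _).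
  by case=> [r _||]; rewrite ?eqxx// -EFinM ltry.
- exact: measurable_phase_cell.
- by move=> z _; rewrite lee_fin expR_ge0.
- exact/measurable_EFinP.
- by rewrite invr_ge0 fine_ge0// integral_ge0// => z _; rewrite lee_fin expR_ge0.
Qed.

Lemma test_phase_linear a f g :
  test_phase S f -> test_phase S g -> test_phase S (fun z => a * f z + g z).
Proof.
move=> [sf pf [r fr]] [sg pg [r' gr]]; split; first exact: smooth_linear.
  move=> p; move: (pf p) (pg p); rewrite /periodic.
  by case: position => // c hf hg q i; rewrite hf hg.
(* Outside the larger of the two radii both functions vanish. *)
exists (Num.max r r') => q p; rewrite gt_max.
have -> : beyond (position S) (Num.max r r') q =
    beyond (position S) r q && beyond (position S) r' q.
  by rewrite /beyond; case: position => //; rewrite gt_max.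
by case/orP => /andP[h h']; rewrite fr ?gr ?h ?h' ?orbT// mulr0 addr0.
Qed.

Lemma L_langevin_linear gamma a f g z : smooth f -> smooth g ->
  L_langevin S gamma (fun w => a * f w + g w) z =
  a * L_langevin S gamma f z + L_langevin S gamma g z.
Proof.
move=> sf sg.
have ham_eq (p w x y x' y' : R) : p * (a * x + y) - w * (a * x' + y') =
  a * (p * x - w * x') + (p * y - w * y') by ring.
have FD_eq (p b x y x' y' : R) : - (p * (a * x + y)) + b * (a * x' + y') =
  a * (- (p * x) + b * x') + (- (p * y) + b * y') by ring.
have L_eq (x y x' y' : R) : a * x + y + gamma * (a * x' + y') =
  a * (x + gamma * x') + (y + gamma * y') by ring.
have dl v : (fun w => 'D_v (fun w => a * f w + g w) w) =
    (fun w => a * 'D_v f w + 'D_v g w).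
  by apply/funext => w; rewrite derive_linear//; exact: smooth_derivable.
have dl' v w : 'D_v (fun w => a * f w + g w) w = a * 'D_v f w + 'D_v g w.
  exact: (congr1 (fun h => h w) (dl v)).
have ddl v w : 'D_v (fun w => 'D_v (fun w => a * f w + g w) w) w =
    a * 'D_v (fun w => 'D_v f w) w + 'D_v (fun w => 'D_v g w) w.
  by rewrite dl derive_linear//; apply: smooth_derivable; exact: smooth_derive.
rewrite /L_langevin.
have -> : L_ham S (fun w => a * f w + g w) z = a * L_ham S f z + L_ham S g z.
  rewrite /L_ham mulr_sumr -big_split/=; apply: eq_bigr => i _.
  by rewrite /dq /dp !dl'; exact: ham_eq.
have -> : L_FD S (fun w => a * f w + g w) z = a * L_FD S f z + L_FD S g z.
  rewrite /L_FD mulr_sumr -big_split/=; apply: eq_bigr => i _.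
  by rewrite /dp ddl dl'; exact: FD_eq.
exact: L_eq.
Qed.

(** The hypocoercive inequality concerns centred test functions, while the core consists of
    uncentred ones; since constants are annihilated, both have the same image. *)
Lemma L_langevin_sub_cst gamma f c : smooth f ->
  L_langevin S gamma (fun w => f w - c) = L_langevin S gamma f.
Proof.
move=> sf.
have dqE i : dq i (fun w => f w - c) = dq i f := derive_sub_cst c _ sf.
have dpE i : dp i (fun w => f w - c) = dp i f := derive_sub_cst c _ sf.
have hamE : L_ham S (fun w => f w - c) = L_ham S f.
  apply/funext => z; apply: eq_bigr => i _.
  by rewrite dqE dpE.
have FDE : L_FD S (fun w => f w - c) = L_FD S f.
  apply/funext => z; apply: eq_bigr => i _.
  by rewrite dpE.
by apply/funext => z; rewrite /L_langevin hamE FDE.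
Qed.

Lemma on_test_linear gamma a x y u v :
  on_test (L_langevin S gamma) x u -> on_test (L_langevin S gamma) y v ->
  on_test (L_langevin S gamma) (a *: x + y : H) (a *: u + v).
Proof.
have cls (x1 x2 : H) f1 f2 : L2_class x1 f1 -> L2_class x2 f2 ->
    L2_class (a *: x1 + x2) (fun z => a * f1 z + f2 z).
  move=> c1 c2.
  apply: filterS (filterI (L2_funD (a *: x1) x2)
    (filterI (L2_funZ a x1) (filterI c1 c2))).
  by move=> t [Dt [Zt [t1 t2]]] tT; rewrite Dt//= Zt// t1// t2.
move=> [f [tf xf uf]] [g [tg yg vg]]; exists (fun z => a * f z + g z); split.
- exact: test_phase_linear.
- exact: cls.
- rewrite (_ : L_langevin _ _ _ =
    fun z => a * L_langevin S gamma f z + L_langevin S gamma g z);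
    first exact: cls.
  by apply/funext => z; rewrite L_langevin_linear//; [case: tf|case: tg].
Qed.

(** The closure of a linear graph is linear; the equivalence in [is_generator] then returns
    membership in the domain and the value of [L] together. *)
Lemma generator_linear gamma (dom : set H) L a x y :
  is_generator gamma dom L -> dom x -> dom y ->
  dom (a *: x + y) /\ L (a *: x + y) = a *: L x + L y.
Proof.
move=> gL dx dy.
have [u [u' [uu' ux uLx]]] := (gL x (L x)).2 (conj dx erefl).
have [v [v' [vv' vy vLy]]] := (gL y (L y)).2 (conj dy erefl).
apply/gL; exists (fun n => a *: u n + v n), (fun n => a *: u' n + v' n); split.
- by move=> n; exact: on_test_linear.
- by apply: cvgD => //; apply: cvgZ => //; exact: cvg_cst.
- by apply: cvgD => //; apply: cvgZ => //; exact: cvg_cst.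
Qed.

(** Density argument: take $u_n \to x$ in the core with $L u_n \to L x$, apply the inequality to the
    centred $u_n$, and pass to the limit, [A] being continuous. *)
Lemma generator_coercive (A Astar : H -> H) eps_bar lambda_bar lambda_tilde gamma
    (dom : set H) L x :
  is_operator_A A -> is_adjoint A Astar ->
  hypocoercive A eps_bar lambda_bar lambda_tilde -> 0 < gamma ->
  is_generator gamma dom L -> dom x -> L2_mean x = 0 ->
  lambda_tilde gamma * `|x| ^+ 2 <=
    L2_dot (- L x) x + eps_bar * gamma_min gamma * L2_dot (A (L x)) x +
    eps_bar * gamma_min gamma * L2_dot (A x) (L x).
Proof.
move=> hA hAs [_ _ hyp] gamma0 gL domx mx.
have [_ _ coer] := hyp _ gamma0.
have [e e1] := exists_L2_one gibbs_finite.
have [u [v [uv ux vLx]]] := (gL x (L x)).2 (conj domx erefl).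
have lA := is_adjoint_linear hAs.
have kA y : `|A y| <= 2^-1 * `|y| by rewrite mulrC operator_A_le.
(* Centring does not change the limit, because the means of [u n] tend to the mean of [x], which is
   0. *)
pose w n := u n - L2_dot (u n) e *: e.
have wx : w n @[n --> \oo] --> x.
  rewrite -[X in _ --> X]subr0 -(scale0r e) -mx (L2_meanE e1).
  apply: cvgB => //; apply: cvgZ; last exact: cvg_cst.
  by apply: cvg_L2_dot => //; exact: cvg_cst.
have Av := linear_bounded_cvg lA kA vLx.
have Aw := linear_bounded_cvg lA kA wx.
apply: (@ler_cvg_to _ \oo _ _ (fun n => lambda_tilde gamma * `|w n| ^+ 2)
  (fun n => L2_dot (- v n) (w n) + eps_bar * gamma_min gamma * L2_dot (A (v n)) (w n) +
    eps_bar * gamma_min gamma * L2_dot (A (w n)) (v n))).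
- apply: cvgM; first exact: cvg_cst.
  under eq_fun do rewrite -L2_dotxx. 
  by rewrite -L2_dotxx; exact: cvg_L2_dot.
- apply: cvgD; first apply: cvgD.
  + by apply: cvg_L2_dot => //; exact: cvgN.
  + by apply: cvgM; [exact: cvg_cst|exact: cvg_L2_dot].
  + by apply: cvgM; [exact: cvg_cst|exact: cvg_L2_dot].
- near=> n; have [f [tf uf vf]] := uv n; have [sf _ _] := tf.
  apply: (coer f (w n) (v n) tf); last by rewrite L_langevin_sub_cst.
  rewrite /w -(L2_class_mean e1 _ uf); first exact: L2_class_sub_cst.
  exact: (continuous_measurable_phase (smooth_continuous sf)).
Unshelve. all: end_near. Qed.

End generator.

(** * Linear flows on finite-dimensional spaces *)

Lemma cvg_vector_sum (R : numFieldType) (V : normedModType R) (I J : Type)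
    (F : set_system J) {FF : Filter F} (r : seq I) (u : I -> J -> V) (l : I -> V) :
  (forall i, u i j @[j --> F] --> l i) ->
  \sum_(i <- r) u i j @[j --> F] --> \sum_(i <- r) l i.
Proof.
by move=> ul; apply: cvg_big => //; exact: add_continuous.
Qed.

(** * The matrix exponential as coordinate power series *)

Section row_exponential.
Context (R : realType) (n : nat) (B : 'M[R]_n).
Implicit Types c : 'rV[R]_n.

(** The $k$-th Taylor coefficient in $t$ of the $j$-th coordinate of $c\,e^{tB}$. Working by
    coordinate makes the results on real power series available. *)
Definition row_exp_coeff c (j : 'I_n) (k : nat) : R :=
  k`!%:R^-1 * (iter k (mulmxr B) c) ord0 j.

Definition row_exp c (j : 'I_n) (t : R) : R := limn (pseries (row_exp_coeff c j) t).

Lemma row_exp_coeff_mul c j k :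
  row_exp_coeff (c *m B) j k = \sum_i row_exp_coeff c i k * B i j.
Proof.
rewrite /row_exp_coeff -[iter k _ (c *m B)]iterSr iterS mxE mulr_sumr.
by apply: eq_bigr => i _; rewrite mulrA.
Qed.

(** Since $(k+1)/(k+1)! = 1/k!$, formal differentiation gives the same kind of series started from
    $cB$. *)
Lemma row_exp_coeff_diffs c j :
  pseries_diffs (row_exp_coeff c j) = row_exp_coeff (c *m B) j.
Proof.
apply/funext => k; rewrite /pseries_diffs /row_exp_coeff iterSr mulrA; congr (_ * _).
by rewrite factS natrM invfM mulrA divff ?mul1r// pnatr_eq0.
Qed.

(** The sum $K$ of all $|B_{il}|$ dominates each step of the iteration, so the series is dominated
    by that of $e^{K|t|}$ times a constant. *)
Lemma row_exp_coeff_le c j k :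
  `|row_exp_coeff c j k| <=
  k`!%:R^-1 * ((\sum_i \sum_l `|B i l|) ^+ k * \sum_i `|c ord0 i|).
Proof.
rewrite normrM ger0_norm ?invr_ge0 ?ler0n// ler_wpM2l ?invr_ge0 ?ler0n//.
elim: k j => [|k IH] j /=.
  by rewrite expr0 mul1r (bigD1 j)//= lerDl sumr_ge0.
rewrite mxE (le_trans (ler_norm_sum _ _ _))// exprS -mulrA mulr_suml.
apply: ler_sum => i _; rewrite normrM mulrC ler_pM//.
by rewrite (bigD1 j)//= lerDl sumr_ge0.
Qed.

Lemma is_cvg_row_exp c j t : cvgn (pseries (row_exp_coeff c j) t).
Proof.
apply: normed_cvg.
set K := \sum_i \sum_l `|B i l|; set M := \sum_i `|c ord0 i|.
apply: (@series_le_cvg _ (fun k => `|row_exp_coeff c j k * t ^+ k|)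
  (M *: exp_coeff (K * `|t|))) => [k|k|k|].
- by [].
- rewrite mulr_ge0 ?sumr_ge0// divr_ge0// exprn_ge0// mulr_ge0// sumr_ge0// => i _.
  exact: sumr_ge0.
- rewrite normrM normrX.
  apply: le_trans (ler_wpM2r _ (row_exp_coeff_le _ _ _)) _; first exact: exprn_ge0.
  rewrite -[leRHS]/(M * ((K * `|t|) ^+ k / k`!%:R)) exprMn -/K -/M.
  by rewrite le_eqVlt; apply/orP; left; apply/eqP; ring.
- exact/is_cvg_seriesZ/is_cvg_series_exp_coeff.
Qed.

Lemma row_exp0 c j : row_exp c j 0 = c ord0 j.
Proof.
(* The shift discards the empty partial sum; from one term on, the partial sums at 0 all equal the
   constant coefficient. *)
apply: cvg_lim => //; rewrite -(cvg_shiftS _).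
rewrite (_ : (fun k => _) = fun=> c ord0 j); first exact: cvg_cst.
apply/funext => k; rewrite /pseries /series /= big_nat_recl//= big1 ?addr0.
  by rewrite /row_exp_coeff/= fact0 invr1 expr0 mulr1 mul1r.
by move=> i _; rewrite expr0n mulr0.
Qed.

(** This is $cB\,e^{tB} = c\,e^{tB}B$: [B] commutes with its exponential. *)
Lemma row_exp_mul c j t : row_exp (c *m B) j t = \sum_i row_exp c i t * B i j.
Proof.
apply: cvg_lim => //.
rewrite (_ : pseries _ _ = fun k => \sum_i pseries (row_exp_coeff c i) t k * B i j).
  apply: cvg_vector_sum => i; apply: cvgM; last exact: cvg_cst.
  exact: is_cvg_row_exp.
apply/funext => k; rewrite /pseries /series /=.
under [RHS]eq_bigr do rewrite mulr_suml.
rewrite exchange_big/=; apply: eq_bigr => i _.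
rewrite row_exp_coeff_mul mulr_suml; apply: eq_bigr => l _; ring.
Qed.

Lemma is_derive_row_exp c j (t : R) :
  is_derive t (1 : R) (row_exp c j) (row_exp (c *m B) j t).
Proof.
rewrite /row_exp -row_exp_coeff_diffs.
(* Any radius above $|t|$ would do: the series and its formal derivatives are all of the form
   [row_exp_coeff] and converge everywhere. *)
apply: (@pseries_snd_diffs _ _ (`|t| + 1)).
- exact: is_cvg_row_exp.
- by rewrite row_exp_coeff_diffs; exact: is_cvg_row_exp.
- by rewrite !row_exp_coeff_diffs; exact: is_cvg_row_exp.
- by rewrite [ltRHS]ger0_norm ?addr_ge0// ltrDl.
Qed.

End row_exponential.

(** * Coordinates, surjectivity and flow of an operator on a finite-dimensional space *)

Section finite_dimension.
Context d (T : measurableType d) (R : realType) (m : {measure set T -> \bar R}).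
Local Notation H := (L2 m).
Variables (W : set H) (W_fin : finite_dimensional W).

Lemma finite_dimensional_linear a x y : W x -> W y -> W (a *: x + y).
Proof.
have [n [b ->]] := W_fin; move=> [c ->] [e ->]; exists (fun i => a * c i + e i).
rewrite scaler_sumr -big_split/=; apply: eq_bigr => i _.
by rewrite scalerDl scalerA.
Qed.

Lemma finite_dimensional0 : W 0.
Proof.
have [n [b ->]] := W_fin; exists (fun=> 0).
by rewrite big1// => i _; rewrite scale0r.
Qed.

Lemma finite_dimensionalZ a x : W x -> W (a *: x).
Proof.
by move=> Wx; rewrite -[_ *: _]addr0; apply: finite_dimensional_linear => //;
  exact: finite_dimensional0.
Qed.

Lemma finite_dimensionalB x y : W x -> W y -> W (x - y).
Proof.
by move=> Wx Wy; rewrite addrC -scaleN1r; exact: finite_dimensional_linear.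
Qed.

Lemma finite_dimensional_sum n (b : 'I_n -> H) (c : 'I_n -> R) :
  (forall i, W (b i)) -> W (\sum_i c i *: b i).
Proof.
move=> Wb; elim/big_ind : _ => [|x y Wx Wy|i _].
- exact: finite_dimensional0.
- by rewrite -[x]scale1r; exact: finite_dimensional_linear.
- exact: finite_dimensionalZ.
Qed.

(** [finite_dimensional] provides a spanning family that may be dependent. As long as a nontrivial
    relation exists, a vector with nonzero coefficient is dropped. *)
Lemma exists_basis : exists n (b : 'I_n -> H),
  W = [set x | exists c : 'I_n -> R, x = \sum_i c i *: b i] /\
  forall c : 'I_n -> R, \sum_i c i *: b i = 0 -> forall i, c i = 0.
Proof.
have [n [b]] := W_fin; elim: n b => [|n IH] b Wb.
  by exists 0%N, b; split => // c _ [].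
have [free|] := pselect (forall c : 'I_n.+1 -> R,
    \sum_i c i *: b i = 0 -> forall i, c i = 0); first by exists n.+1, b.
move=> /existsNP[c /not_implyP[c0 /existsNP[i ci]]].
have bi : b i = \sum_j (- (c i)^-1 * c (lift i j)) *: b (lift i j).
  move: c0; rewrite (bigD1_ord i)//= => /eqP; rewrite addr_eq0 => /eqP c0.
  have /eqP ci0 := ci.
  rewrite -[LHS](scalerK ci0) c0 scalerN -scaleNr scaler_sumr.
  by apply: eq_bigr => j _; rewrite scalerA.
(* The span is unchanged: in one direction [b i] is replaced by its expression in the others, in the
   other it gets coefficient 0. *)
apply: (IH (b \o lift i)); rewrite Wb; apply/seteqP; split => x [a ->] /=.
  exists (fun j => a i * (- (c i)^-1 * c (lift i j)) + a (lift i j)).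
  rewrite (bigD1_ord i)//= {1}bi scaler_sumr -big_split/=.
  by apply: eq_bigr => j _; rewrite scalerA scalerDl.
exists (fun k => oapp a 0 (unlift i k)).
rewrite (bigD1_ord i)//= unlift_none scale0r add0r.
by apply: eq_bigr => j _; rewrite liftK.
Qed.

Variables (B : H -> H) (BW : forall x, W x -> W (B x)).
Hypothesis B_linear : forall a x y, W x -> W y -> B (a *: x + y) = a *: B x + B y.

Lemma operator0 : B 0 = 0.
Proof.
have W0 := finite_dimensional0; have := B_linear 1 W0 W0.
by rewrite !scale1r addr0 => /eqP;
  rewrite -[X in X == _]addr0 (inj_eq (addrI _)) eq_sym => /eqP.
Qed.

Lemma operatorZ a x : W x -> B (a *: x) = a *: B x.
Proof.
move=> Wx; rewrite -[a *: x]addr0 B_linear//; last exact: finite_dimensional0.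
by rewrite operator0 addr0.
Qed.

Lemma operator_sum n (b : 'I_n -> H) (c : 'I_n -> R) :
  (forall i, W (b i)) -> B (\sum_i c i *: b i) = \sum_i c i *: B (b i).
Proof.
move=> Wb; suff [] : W (\sum_i c i *: b i) /\
  B (\sum_i c i *: b i) = \sum_i c i *: B (b i) by [].
apply: (@big_ind2 H H (fun x y => W x /\ B x = y)).
- by split; [exact: finite_dimensional0|exact: operator0].
- move=> x1 y1 x2 y2 [Wx1 <-] [Wx2 <-].
  have -> : x1 + x2 = 1 *: x1 + x2 by rewrite scale1r.
  by rewrite B_linear// (scale1r (B x1)); split => //; exact: finite_dimensional_linear.
- by move=> i _; rewrite operatorZ//; split => //; exact: finite_dimensionalZ.
Qed.

Lemma exists_operator_matrix n (b : 'I_n -> H) :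
  W = [set x | exists c : 'I_n -> R, x = \sum_i c i *: b i] ->
  (forall i, W (b i)) /\ exists M : 'M[R]_n, forall c : 'rV[R]_n,
    B (\sum_j c ord0 j *: b j) = \sum_j (c *m M) ord0 j *: b j.
Proof.
move=> Wb; have Wbi i : W (b i).
  rewrite Wb; exists (fun j => (j == i)%:R).
  rewrite (bigD1 i)//= eqxx scale1r big1 ?addr0// => j /negbTE ->.
  by rewrite scale0r.
split => //.
have /choice[f fP] : forall i, exists c : 'I_n -> R, B (b i) = \sum_j c j *: b j.
  by move=> i; have := BW (Wbi i); rewrite {1}Wb.
exists (\matrix_(i, j) f i j) => c; rewrite operator_sum//.
under eq_bigr do rewrite fP scaler_sumr.
rewrite exchange_big/=; apply: eq_bigr => j _.
rewrite mxE scaler_suml; apply: eq_bigr => i _.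
by rewrite mxE scalerA.
Qed.

Lemma operator_surjective x :
  (forall y, W y -> B y = 0 -> y = 0) -> W x -> exists2 y, W y & B y = x.
Proof.
move=> Binj; have [n [b [Wb free]]] := exists_basis.
have [Wbi [M MP]] := exists_operator_matrix Wb.
(* A row [c] of the left kernel gives a vector killed by [B]; injectivity makes the vector 0, and
   freeness of the basis makes [c] zero. *)
have Mfree : row_free M.
  rewrite -kermx_eq0; apply/eqP/row_matrixP => i.
  set c := row i _; rewrite row0.
  have cM : c *m M = 0 by rewrite /c -row_mul mulmx_ker row0.
  apply/rowP => j; rewrite [RHS]mxE.
  apply: (free (fun j => c ord0 j)); apply: Binj; first exact: finite_dimensional_sum.
  by rewrite MP cM big1// => l _; rewrite mxE scale0r.
(* [M] is square, so row freeness is also row fullness, and [pinvmx] solves $eM = c$. *)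
rewrite {1}Wb => -[c ->]; pose e := (\row_j c j) *m pinvmx M.
exists (\sum_j e ord0 j *: b j); first exact: finite_dimensional_sum.
rewrite MP mulmxKpV; first by apply: eq_bigr => j _; rewrite mxE.
by rewrite submx_full// /row_full; move: Mfree.
Qed.

Local Notation flow x t := (op_exp (fun y => t *: B y) x).

Lemma op_exp_rowE n (b : 'I_n -> H) (M : 'M[R]_n) (c : 'rV[R]_n) t :
  (forall i, W (b i)) ->
  (forall c : 'rV[R]_n,
    B (\sum_j c ord0 j *: b j) = \sum_j (c *m M) ord0 j *: b j) ->
  flow (\sum_j c ord0 j *: b j) t = \sum_j row_exp M c j t *: b j.
Proof.
move=> Wb MP.
have iterE k : iter k (fun y => t *: B y) (\sum_j c ord0 j *: b j) =
    t ^+ k *: \sum_j (iter k (mulmxr M) c) ord0 j *: b j.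
  elim: k => [|k IH]; first by rewrite expr0 scale1r.
  rewrite iterS IH operatorZ; last exact: finite_dimensional_sum.
  by rewrite MP scalerA -exprS.
apply: cvg_lim => //.
rewrite (_ : (fun k => _) =
    fun k => \sum_j pseries (row_exp_coeff M c j) t k *: b j).
  apply: cvg_vector_sum => j; apply: cvgZ; last exact: cvg_cst.
  exact: is_cvg_row_exp.
apply/funext => k; rewrite /pseries /series /=.
under [RHS]eq_bigr do rewrite scaler_suml.
rewrite [RHS]exchange_big/=; apply: eq_bigr => i _.
rewrite iterE scalerA scaler_sumr; apply: eq_bigr => j _.
by rewrite scalerA /row_exp_coeff -!mulrA [t ^+ i * _]mulrC.
Qed.

(** Derivatives are stated for linear and quadratic functionals of the flow instead of the curve in
    [H]: in coordinates these are finite sums of real power series and of their products. *)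
Lemma flow_ode x : W x ->
  [/\ flow x 0 = x,
      forall t, W (flow x t),
      forall t, flow (B x) t = B (flow x t),
      forall (f : H -> R) t, scalar f ->
        is_derive t (1 : R) (fun t => f (flow x t)) (f (B (flow x t))) &
      forall (q : H -> H -> R) (t : R),
        (forall y, scalar (q y)) -> (forall y, scalar (q^~ y)) ->
        is_derive t (1 : R) (fun t => q (flow x t) (flow x t))
          (q (B (flow x t)) (flow x t) + q (flow x t) (B (flow x t)))].
Proof.
have [n [b Wb]] := W_fin; have [Wbi [M MP]] := exists_operator_matrix Wb.
rewrite {1}Wb => -[c' ->]; set c : 'rV[R]_n := \row_j c' j.
have -> : \sum_i c' i *: b i = \sum_i c ord0 i *: b i.
  by apply: eq_bigr => i _; rewrite mxE.
have BE t : B (flow (\sum_i c ord0 i *: b i) t) =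
    \sum_j row_exp M (c *m M) j t *: b j.
  rewrite (op_exp_rowE _ _ Wbi MP).
  have := MP (\row_j row_exp M c j t).
  under eq_bigr do rewrite mxE.
  move=> ->; apply: eq_bigr => j _; rewrite row_exp_mul mxE; congr (_ *: _).
  by apply: eq_bigr => i _; rewrite mxE.
have sum_scalar (f : H -> R) (e : 'I_n -> R) : scalar f ->
    f (\sum_j e j *: b j) = \sum_j e j * f (b j).
  move=> lf; have f0 : f 0 = 0.
    by have := lf (-1) 0 0; rewrite scaler0 addr0 mulN1r addNr.
  apply: (@big_ind2 H R (fun u r => f u = r)) => // [u r v s <- <-|j _].
    by have := lf 1 u v; rewrite scale1r mul1r.
  by rewrite -[_ *: _]addr0 lf f0 addr0.
split.
- rewrite (op_exp_rowE _ _ Wbi MP); apply: eq_bigr => j _.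
  by rewrite row_exp0.
- by move=> t; rewrite (op_exp_rowE _ _ Wbi MP); exact: finite_dimensional_sum.
- by move=> t; rewrite BE MP (op_exp_rowE _ _ Wbi MP).
- move=> f t lf.
  rewrite BE sum_scalar//.
  rewrite (_ : (fun t => _) = \sum_j (fun t => row_exp M c j t * f (b j))).
    apply: is_derive_sum => j.
    have := @is_deriveM _ _ _ (cst (f (b j))) t 1 _ _
      (is_derive_row_exp M c j t) (is_derive_cst _ _ _).
    by rewrite scaler0 add0r [_ *: _]mulrC.
  apply/funext => s; rewrite (op_exp_rowE _ _ Wbi MP) sum_scalar//.
  by rewrite fct_sumE.
- move=> q t lq rq.
  have qE (e e' : 'I_n -> R) : q (\sum_j e j *: b j) (\sum_j e' j *: b j) =
      \sum_i \sum_j e i * e' j * q (b i) (b j).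
    rewrite (sum_scalar (q^~ _))//; apply: eq_bigr => i _.
    by rewrite (sum_scalar (q _))// mulr_sumr; apply: eq_bigr => j _; rewrite mulrA.
  rewrite BE (op_exp_rowE _ _ Wbi MP) !qE.
  rewrite (_ : (fun t => _) = \sum_i \sum_j
      (fun t => row_exp M c i t * row_exp M c j t * q (b i) (b j))).
    rewrite -big_split/=; apply: is_derive_sum => i.
    rewrite -big_split/=; apply: is_derive_sum => j.
    have := @is_deriveM _ _ _ (cst (q (b i) (b j))) t 1 _ _
      (is_deriveM (is_derive_row_exp M c i t) (is_derive_row_exp M c j t))
      (is_derive_cst _ _ _).
    rewrite scaler0 add0r => h; apply: (is_derive_eq h).
    rewrite -![_ *: _]/(_ * _) /=; ring.
  apply/funext => s; rewrite (op_exp_rowE _ _ Wbi MP) qE fct_sumE.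
  by apply: eq_bigr => i _; rewrite fct_sumE.
Qed.

End finite_dimension.

(** * Exponential decay *)

Section exponential_decay.
Context (R : realType).
Implicit Types (f F h : R -> R) (t lam K : R).

Lemma is_derive_expRM lam t :
  is_derive t (1 : R) (fun s => expR (lam * s)) (lam * expR (lam * t)).
Proof.
have h : is_derive t (1 : R) (fun s => lam * s) lam.
  have := is_deriveZ lam (is_derive_id t (1 : R)).
  by rewrite [lam *: 1]mulr1.
have := is_derive1_comp (is_derive_expR (lam * t)) h.
by rewrite mulrC.
Qed.

(** The integrating factor makes $e^{\lambda s}h(s)$ nonincreasing on $[0, t]$. *)
Lemma gronwall_le h h' lam t : (forall s, is_derive s (1 : R) h (h' s)) ->
  (forall s, 0 <= s -> h' s <= - lam * h s) -> 0 <= t ->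
  h t <= expR (- lam * t) * h 0.
Proof.
move=> dh hh t0; pose g s := expR (lam * s) * h s.
have dg s : is_derive s (1 : R) g (expR (lam * s) * (h' s + lam * h s)).
  apply: (is_derive_eq (is_deriveM (is_derive_expRM lam s) (dh s))).
  rewrite -![_ *: _]/(_ * _); ring.
have gt0 : g t <= g 0.
  apply: (@ler0_derive1_nincr _ g 0 t) => //.
  - by move=> s; rewrite in_itv/= => /andP[s0 _];
      rewrite derive1E derive_val pmulr_rle0 ?expR_gt0//;
      have := hh s (ltW s0); lra.
  - apply: continuous_subspaceT => s.
    by apply: differentiable_continuous; apply/derivable1_diffP.
move: gt0; rewrite /g mulr0 expR0 mul1r => /(ler_wpM2l (expR_ge0 (- lam * t))).
by rewrite mulrA -expRD mulNr addNr expR0 mul1r.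
Qed.

Lemma is_derive_continuous f f' :
  (forall s, is_derive s (1 : R) f (f' s)) -> continuous f.
Proof.
move=> df s; have := df s.
by move=> d; apply: differentiable_continuous; apply/derivable1_diffP.
Qed.

(** For a nonnegative function, the finite value given by the fundamental theorem of calculus
    already proves integrability. *)
Lemma ge0_integrable_FTC2y f F (l : R) : (forall t, 0 <= t -> 0 <= f t) ->
  continuous f -> (forall t, is_derive t (1 : R) F (f t)) ->
  F t @[t --> +oo] --> l ->
  lebesgue_measure.-integrable `[0, +oo[ (EFin \o f) /\
  (\int[lebesgue_measure]_(t in `[0, +oo[) f t)%R = l - F 0.
Proof.
move=> f0 cf dF Fl.
have I : (\int[lebesgue_measure]_(t in `[0%R, +oo[) (f t)%:E = l%:E - (F 0)%:E)%E.
  apply: ge0_continuous_FTC2y => //.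
  - exact: continuous_subspaceT.
  - by apply: cvg_at_right_filter; exact: (is_derive_continuous dF).
  - by move=> t _; rewrite derive1E; exact: derive_val.
split; last by rewrite /Rintegral I.
apply/integrableP; split.
  apply/measurable_EFinP; apply: measurable_funTS.
  exact: continuous_measurable_fun.
under eq_integral => t.
  rewrite inE/= in_itv/= andbT => t0; rewrite ger0_norm ?f0//; over.
by rewrite I -EFinB ltry.
Qed.

Lemma cvg_expR_decay lam : 0 < lam -> expR (- lam * t) @[t --> +oo] --> 0.
Proof.
move=> lam0.
rewrite (_ : (fun t => _) = (fun z => expR (- z)) \o (fun z => lam * z)); last first.
  by apply/funext => t; rewrite /= mulNr.
apply: (@cvg_comp _ _ _ _ _ _ (pinfty_nbhs R)); last exact: cvgr_expR.
exact: gt0_cvgMry.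
Qed.

(* [f] need not have a sign: the primitive is computed for [f + K exp(- lam t)]
   and [K exp(- lam t)], which are both nonnegative. *)
Lemma integrable_exp_decay f F lam K : 0 < lam -> 0 <= K -> continuous f ->
  (forall t, is_derive t (1 : R) F (f t)) ->
  (forall t, 0 <= t -> `|f t| <= K * expR (- lam * t)) ->
  F t @[t --> +oo] --> 0 ->
  lebesgue_measure.-integrable `[0, +oo[ (EFin \o f) /\
  (\int[lebesgue_measure]_(t in `[0, +oo[) f t)%R = - F 0.
Proof.
move=> lam0 K0 cf dF fK F0.
pose e t := K * expR (- lam * t); pose E t := - (K / lam) * expR (- lam * t).
have dE t : is_derive t (1 : R) E (e t).
  apply: (is_derive_eq (is_deriveZ (- (K / lam)) (is_derive_expRM (- lam) t))).
  by rewrite -![_ *: _]/(_ * _) /e; field; rewrite gt_eqF.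
have de t : is_derive t (1 : R) e (K *: (- lam * expR (- lam * t))).
  exact: is_deriveZ (is_derive_expRM (- lam) t).
have E0 : E t @[t --> +oo] --> 0.
  rewrite -(mulr0 (- (K / lam))); apply: cvgM; first exact: cvg_cst.
  exact: cvg_expR_decay.
have [ie Ie] := ge0_integrable_FTC2y (fun t _ => mulr_ge0 K0 (expR_ge0 _))
  (is_derive_continuous de) dE E0.
have [ife Ife] : lebesgue_measure.-integrable `[0, +oo[ (EFin \o (f \+ e)) /\
    (\int[lebesgue_measure]_(t in `[0, +oo[) (f \+ e) t)%R = 0 - (F 0 + E 0).
  apply: (@ge0_integrable_FTC2y _ (F \+ E)).
  - by move=> t t0; have := fK t t0; rewrite ler_norml /= => /andP[]; rewrite /e; lra.
  - by move=> t; apply: cvgD; [exact: cf|exact: (is_derive_continuous de)].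
  - by rewrite -[X in _ --> X]addr0; exact: cvgD.
split.
  rewrite (_ : EFin \o f = (EFin \o (f \+ e)%R) \- (EFin \o e))%E.
    exact: integrableB.
  by apply/funext => t /=; rewrite -EFinB addrK.
have -> : (\int[lebesgue_measure]_(t in `[0, +oo[) f t =
    \int[lebesgue_measure]_(t in `[0, +oo[) ((f \+ e) t - e t))%R.
  by apply: eq_Rintegral => t _; rewrite /= addrK.
by rewrite RintegralB// Ie Ife; ring.
Qed.

End exponential_decay.

(** * Decay and inverse for an operator satisfying the hypocoercive inequality *)

Section coercive_semigroup.
Context d (T : measurableType d) (R : realType) (m : {measure set T -> \bar R}).
Local Notation H := (L2 m).
Variables (W : set H) (W_fin : finite_dimensional W).
Variables (B : H -> H) (BW : forall x, W x -> W (B x)).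
Hypothesis B_linear : forall a x y, W x -> W y -> B (a *: x + y) = a *: B x + B y.
Variables (A : H -> H) (eps lam : R).
Hypotheses (A_linear : linear A) (A_le : forall x, `|A x| <= `|x| / 2).
Hypotheses (eps_ge0 : 0 <= eps) (eps_lt1 : eps < 1) (lam_gt0 : 0 < lam).
Hypothesis coercive : forall x, W x -> lam * (1 + eps) * `|x| ^+ 2 <=
  L2_dot (- B x) x + eps * L2_dot (A (B x)) x + eps * L2_dot (A x) (B x).

Local Notation flow x t := (op_exp (fun y => t *: B y) x).

Lemma dot_A_le x y : `|L2_dot (A x) y| <= `|x| * `|y| / 2.
Proof.
by rewrite (le_trans (L2_cauchy_schwarz _ _))// mulrAC ler_wpM2r.
Qed.

(** Each term with [A] is at most $\varepsilon|x||Bx|/2$, so the right side of [coercive] is at most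
    $(1+\varepsilon)|x||Bx|$. This yields both injectivity and the norm of the inverse. *)
Lemma coercive_norm_le x : W x -> `|x| <= lam^-1 * `|B x|.
Proof.
move=> Wx; have [->|x0] := eqVneq x 0.
  by rewrite normr0 mulr_ge0// invr_ge0 ltW.
have nx : 0 < `|x| by rewrite normr_gt0.
rewrite mulrC ler_pdivlMr// mulrC.
have := coercive Wx; rewrite L2_dotNl.
have := L2_cauchy_schwarz (B x) x; have := dot_A_le (B x) x.
have := dot_A_le x (B x); rewrite !ler_norml => /andP[_ h1] /andP[_ h2] /andP[h3 _] h4.
rewrite -(@ler_pM2r _ ((1 + eps) * `|x|)); last by rewrite mulr_gt0// ltr_wpDr.
have := ler_wpM2l eps_ge0 h1; have := ler_wpM2l eps_ge0 h2.
lra.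
Qed.

(* The modified squared norm of the hypocoercive method. *)
Let entropy x y : R := 2^-1 * L2_dot x y - eps * L2_dot (A x) y.

Lemma flow_norm_le x t : W x -> 0 <= t ->
  `|flow x t| <= Num.sqrt ((1 + eps) / (1 - eps)) * expR (- lam * t) * `|x|.
Proof.
move=> Wx t0; have [fl0 flW _ _ flq] := flow_ode W_fin BW B_linear Wx.
have entropy_le y : entropy y y <= (1 + eps) / 2 * `|y| ^+ 2.
  rewrite /entropy L2_dotxx; have := dot_A_le y y.
  by rewrite ler_norml => /andP[+ _] => /(ler_wpM2l eps_ge0); lra.
have entropy_ge y : (1 - eps) / 2 * `|y| ^+ 2 <= entropy y y.
  rewrite /entropy L2_dotxx; have := dot_A_le y y.
  by rewrite ler_norml => /andP[_] => /(ler_wpM2l eps_ge0); lra.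
have lin1 y : scalar (entropy y).
  by move=> a u v; rewrite /entropy !L2_dotDr !L2_dotZr; ring.
have lin2 y : scalar (entropy^~ y).
  by move=> a u v; rewrite /entropy A_linear !L2_dotDl !L2_dotZl; ring.
(* Along the flow the derivative of [entropy] is minus the right side of [coercive]; the upper bound
   on [entropy] turns this into decay at rate [2 * lam]. *)
have := gronwall_le (fun s => flq entropy s lin1 lin2) (lam := 2 * lam) _ t0.
rewrite fl0 => /(_ _)/wrap[s _|h].
  have := coercive (flW s); rewrite /entropy L2_dotNl (L2_dotC (flow x s) (B _)) => c.
  have := ler_wpM2l (ltW lam_gt0) (entropy_le (flow x s)).
  rewrite /entropy; lra.
have e1 : 0 < 1 - eps by rewrite subr_gt0.
rewrite -ler_sqr ?nnegrE ?mulr_ge0 ?sqrtr_ge0 ?expR_ge0//.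
rewrite !exprMn sqr_sqrtr; last by rewrite divr_ge0 ?(ltW e1)// addr_ge0.
rewrite -expRM_natl.
have -> : 2 * (- lam * t) = - (2 * lam) * t by ring.
rewrite -[leRHS]mulrA [leRHS]mulrAC ler_pdivlMr//.
have := le_trans (entropy_ge _) h.
have := ler_wpM2l (expR_ge0 (- (2 * lam) * t)) (entropy_le x).
lra.
Qed.

Lemma coercive_inverse : exists Q : H -> H,
  [/\ inverse_on W B Q,
      is_integral_on W (fun t x => flow x t) (fun x => - Q x) &
      forall x, W x -> `|Q x| <= lam^-1 * `|x|].
Proof.
have Binj y : W y -> B y = 0 -> y = 0.
  move=> Wy By; apply/eqP; rewrite -normr_le0.
  by have := coercive_norm_le Wy; rewrite By normr0 mulr0.
(* [Q] is a total function but is constrained only on [W]; outside, its values are arbitrary. *)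
have /choice[Q QP] : forall x, exists y, W x -> W y /\ B y = x.
  move=> x; have [Wx|nWx] := pselect (W x); last by exists 0.
  by have [y Wy yx] := operator_surjective W_fin BW B_linear Binj Wx; exists y.
have BB u v : W u -> W v -> B (u - v) = B u - B v.
  by move=> Wu Wv; rewrite addrC -scaleN1r B_linear// scaleN1r addrC.
exists Q; split.
- move=> x Wx; have [WQ BQ] := QP _ Wx; split => //; first exact: BW.
  have [WQB BQB] := QP _ (BW Wx).
  apply/eqP; rewrite -subr_eq0; apply/eqP/Binj; first exact: finite_dimensionalB.
  by rewrite BB// BQB subrr.
- split.
    move=> x /QP[WQ _]; rewrite -scaleN1r; exact: finite_dimensionalZ.
  move=> x y Wx Wy; have [WQ BQ] := QP _ Wx.
  have [fl0 _ flB flf _] := flow_ode W_fin BW B_linear WQ.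
  have [_ _ _ flf' _] := flow_ode W_fin BW B_linear Wx.
  have ly : scalar (@L2_dot _ _ _ m ^~ y).
    by move=> a u v; rewrite L2_dotDl L2_dotZl.
  set C := Num.sqrt ((1 + eps) / (1 - eps)).
  (* The flow commutes with [B] and $BQx = x$, so the flow started at [Q x] is a primitive of the
     flow started at [x]. It decays at infinity, and the integral is minus its value at 0. *)
  have dF t : is_derive t (1 : R) (fun t => L2_dot (flow (Q x) t) y)
      (L2_dot (flow x t) y).
    by rewrite -[in L2_dot (flow x t) y]BQ flB; exact: (flf _ t ly).
  have [| | | |] := @integrable_exp_decay _ (fun t => L2_dot (flow x t) y)
    (fun t => L2_dot (flow (Q x) t) y) lam (C * `|x| * `|y|) lam_gt0.
  + by rewrite !mulr_ge0 ?sqrtr_ge0.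
  + exact: (is_derive_continuous (fun t => flf' _ t ly)).
  + move=> t t0; rewrite (le_trans (L2_cauchy_schwarz _ _))//.
    rewrite [leRHS]mulrAC ler_wpM2r// mulrAC; exact: flow_norm_le.
  + apply: (@squeeze_cvgr _ _ _ _ (fun t => - (C * `|Q x| * `|y| * expR (- lam * t)))
      (fun t => C * `|Q x| * `|y| * expR (- lam * t))).
    * near=> t; have t0 : 0 <= t by near: t; exact: nbhs_pinfty_ge.
      rewrite -ler_norml (le_trans (L2_cauchy_schwarz _ _))//.
      rewrite [leRHS]mulrAC ler_wpM2r// mulrAC; exact: flow_norm_le.
    * rewrite -oppr0 -(mulr0 (C * `|Q x| * `|y|)); apply: cvgN;
        apply: cvgM; first exact: cvg_cst.
      exact: cvg_expR_decay.
    * rewrite -(mulr0 (C * `|Q x| * `|y|)); apply: cvgM; first exact: cvg_cst.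
      exact: cvg_expR_decay.
  by move=> int intE; split => //; rewrite L2_dotNl intE fl0.
- by move=> x /QP[WQ BQ]; rewrite -{2}BQ; exact: coercive_norm_le.
Unshelve. all: end_near. Qed.

End coercive_semigroup.

(** * Galerkin discretization *)

(** Normalize [x] to the unit sphere. Finiteness ensures that [fine] returns the actual norm and not
    its default 0. *)
Lemma opnorm_le d (T : measurableType d) (R : realType)
    (m : {measure set T -> \bar R}) (Q : L2 m -> L2 m) (x : L2 m) :
  opnorm setT Q \is a fin_num -> (forall a, Q (a *: x) = a *: Q x) ->
  `|Q x| <= fine (opnorm setT Q) * `|x|.
Proof.
move=> Qfin QZ; have [x0|x0] := eqVneq x 0.
  by have := QZ 0; rewrite x0 scale0r => ->; rewrite scale0r !normr0 mulr0.
have nx : 0 < `|x| by rewrite normr_gt0.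
rewrite -ler_pdivrMr// -lee_fin fineK//.
apply: ereal_sup_ubound; exists (`|x|^-1 *: x).
  by split => //=; rewrite normrZ normfV normr_id mulVf// gt_eqF.
by rewrite QZ normrZ normfV normr_id mulrC.
Qed.

(** Because $\min(\gamma, \gamma^{-1}) \le 1$, $\varepsilon$ is bounded by [eps_bar] uniformly in
    $\gamma$; this makes the final constant independent of $\gamma$. *)
Lemma hypocoercive_eps (R : realType) (eps_bar gamma : R) :
  0 < eps_bar -> 0 < gamma -> 0 < eps_bar * gamma_min gamma <= eps_bar.
Proof.
move=> e0 g0; rewrite mulr_gt0 ?lt_min ?g0 ?invr_gt0//=.
rewrite ler_piMr ?(ltW e0)// /gamma_min ge_min.
by have [//|g1/=] := leP gamma 1; rewrite invf_le1// ltW.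
Qed.

(* With r = (1 - P) L x, the first term is unchanged because <r, x> = 0 and the
   other two lose <A r, x> + <A x, r> = <(A + A^* ) r, x>. *)
Lemma galerkin_coercive d (T : measurableType d) (R : realType)
    (m : {measure set T -> \bar R}) (A Astar P : L2 m -> L2 m) (W : set (L2 m))
    (x y : L2 m) (eps lam delta : R) :
  is_adjoint A Astar -> orthogonal_projector W P -> W x -> 0 <= eps ->
  `|A (y - P y) + Astar (y - P y)| <= delta * `|x| ->
  lam * `|x| ^+ 2 <= L2_dot (- y) x + eps * L2_dot (A y) x + eps * L2_dot (A x) y ->
  (lam - eps * delta) * `|x| ^+ 2 <=
    L2_dot (- P y) x + eps * L2_dot (A (P y)) x + eps * L2_dot (A x) (P y).
Proof.
move=> AA PP Wx e0; have [_ /(_ _ Wx)] := PP y.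
have : y = P y + (y - P y) by rewrite addrC subrK.
move: (y - P y) => r; move: (P y) => z -> rx rle.
have AD : A (z + r) = A z + A r.
  by have := is_adjoint_linear AA 1 z r; rewrite !scale1r.
rewrite AD opprD L2_dotDr !L2_dotDl !L2_dotNl rx => h.
have := L2_dot_le (A r + Astar r) x; rewrite L2_dotDl (L2_dotC (Astar r)) -AA => h1.
have := ler_wpM2r (normr_ge0 x) rle => h2.
have := ler_wpM2l e0 (le_trans h1 h2).
lra.
Qed.

Theorem corollary2 (R : realType) (D : nat) (D_gt0 : (0 < D)%N)
    (S : langevin_system R D) (hV : potential_assumption S)
    (A Astar : L2 (gibbs S) -> L2 (gibbs S))
    (hA : is_operator_A A) (hAstar : is_adjoint A Astar)
    (eps_bar lambda_bar : R) (lambda_tilde : R -> R)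
    (hyp : hypocoercive A eps_bar lambda_bar lambda_tilde) :
  exists2 C : R, 1 <= C &
  forall gamma : R, 0 < gamma ->
  forall (dom : set (L2 (gibbs S))) (L : L2 (gibbs S) -> L2 (gibbs S)),
    is_generator gamma dom L ->
  forall (V : nat -> set (L2 (gibbs S)))
         (P : nat -> L2 (gibbs S) -> L2 (gibbs S)),
    (forall M, (1 <= M)%N ->
      [/\ finite_dimensional (V M),
          V M `<=` [set x | L2_mean x = 0],
          V M `<=` dom &
          orthogonal_projector (V M) (P M)]) ->
    opnorm setT (fun x => A (L (P M x) - P M (L (P M x)))
                        + Astar (L (P M x) - P M (L (P M x))))
      @[M --> \oo] --> 0%E ->
  exists (M0 : nat) (lambda : nat -> R),
    lambda M @[M --> \oo] --> rate eps_bar lambda_tilde gamma /\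
    forall M, (M0 <= M)%N ->
      let LM := fun x => P M (L (P M x)) in
      let expLM := fun (t : R) => op_exp (fun x => t *: LM x) in
      [/\ 0 < lambda M,
          forall x t, V M x -> 0 <= t ->
            `|expLM t x| <= C * expR (- lambda M * t) * `|x| &
          exists LMinv : L2 (gibbs S) -> L2 (gibbs S),
            [/\ inverse_on (V M) LM LMinv,
                is_integral_on (V M) expLM (fun x => - LMinv x) &
                (opnorm (V M) LMinv <= (C / lambda M)%:E)%E]].
Proof.
have [/andP[eb0 eb1] _ hyp'] := hyp.
have C1 : 1 <= Num.sqrt ((1 + eps_bar) / (1 - eps_bar)).
  by rewrite -[leLHS]sqrtr1 ler_wsqrtr// ler_pdivlMr ?subr_gt0// mul1r; lra.
(* The constant is built from [eps_bar], before $\gamma$ is introduced. *)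
exists (Num.sqrt ((1 + eps_bar) / (1 - eps_bar))) => // gamma gamma0 dom L gL V P VP.
pose Q M x := A (L (P M x) - P M (L (P M x))) + Astar (L (P M x) - P M (L (P M x))).
move=> Qcvg.
have [lt0 _ _] := hyp' _ gamma0.
have /andP[eps0 eps_le] := hypocoercive_eps eb0 gamma0.
set eps := eps_bar * gamma_min gamma in eps0 eps_le.
have eps1 : eps < 1 by exact: le_lt_trans eb1.
pose delta M := fine (opnorm setT (Q M)).
pose lambda M := (lambda_tilde gamma - eps * delta M) / (1 + eps).
have lambda_cvg : lambda M @[M --> \oo] --> rate eps_bar lambda_tilde gamma.
  apply: cvgM; last exact: cvg_cst.
  rewrite -[X in _ --> X]subr0 -[X in _ - X](mulr0 eps).
  apply: cvgB; first exact: cvg_cst.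
  apply: cvgM; first exact: cvg_cst.
  exact: fine_cvg.
(* Convergence of the defect to 0 makes its norm finite for large [M], and the positive limit of
   [lambda] makes [lambda M] positive. *)
have [M0 _ M0P] : \forall M \near \oo,
    [/\ (1 <= M)%N, opnorm setT (Q M) \is a fin_num & 0 < lambda M].
  near=> M; split; near: M.
  - exact: nbhs_infty_ge.
  - by have /fine_cvgP[] := Qcvg.
  - by apply: (cvgr_gt _ lambda_cvg); rewrite /rate divr_gt0 ?addr_gt0//.
exists M0, lambda; split => // M /M0P[M1 Qfin lam0] LM expLM.
have [Vfin Vmean Vdom PP] := VP _ M1.
have PV x : V M x -> P M x = x.
  by apply: orthogonal_projector_id PP; exact: finite_dimensionalB.
have PVM x : V M (P M x) by have [] := PP x.
have P_linear : linear (P M).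
  by apply: (orthogonal_projector_linear _ PP); exact: finite_dimensional_linear.
have L_linear a x y : V M x -> V M y -> L (a *: x + y) = a *: L x + L y.
  by move=> Vx Vy; have [] := generator_linear a gL (Vdom _ Vx) (Vdom _ Vy).
have LM_V x : V M x -> V M (LM x) by move=> _; exact: PVM.
have LM_linear a x y : V M x -> V M y -> LM (a *: x + y) = a *: LM x + LM y.
  by move=> Vx Vy; rewrite /LM P_linear L_linear ?P_linear//; exact: PVM.
have LZ a x : L (a *: P M x) = a *: L (P M x).
  exact: (operatorZ Vfin L_linear).
have A_linear := is_adjoint_linear hAstar.
have As_linear := is_adjoint_linear (is_adjoint_sym hAstar).
have linZ (F : L2 (gibbs S) -> L2 (gibbs S)) a x : linear F -> F (a *: x) = a *: F x.
  move=> lF; have F0 : F 0 = 0.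
    by have := lF (-1) 0 0; rewrite scaler0 addr0 scaleN1r addNr.
  by rewrite -[a *: x]addr0 lF F0 addr0.
have QZ x a : V M x -> Q M (a *: x) = a *: Q M x.
  by move=> Vx; rewrite /Q (linZ (P M))// LZ (linZ (P M))// -scalerBr
    (linZ A)// (linZ Astar)// scalerDr.
(* Multiplying [lambda M] by $1+\varepsilon$ restores [lambda_tilde gamma] minus the Galerkin error
   $\varepsilon\delta_M$. *)
have coer x : V M x -> lambda M * (1 + eps) * `|x| ^+ 2 <=
    L2_dot (- LM x) x + eps * L2_dot (A (LM x)) x + eps * L2_dot (A x) (LM x).
  move=> Vx; rewrite /lambda divfK; last by rewrite gt_eqF// addr_gt0.
  apply: (galerkin_coercive hAstar PP Vx (ltW eps0)).
    by apply: (opnorm_le Qfin) => a; exact: QZ.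
  rewrite PV//.
  by apply: (generator_coercive hA hAstar hyp gamma0 gL); [exact: Vdom|exact: Vmean].
have A_le x : `|A x| <= `|x| / 2 by exact: operator_A_le.
split => //.
  move=> x t Vx t0.
  apply: le_trans (flow_norm_le Vfin LM_V LM_linear A_linear A_le (ltW eps0)
    eps1 lam0 coer Vx t0) _.
  (* The quotient $(1+\varepsilon)/(1-\varepsilon)$ increases with $\varepsilon$, so [eps] may be
     replaced by [eps_bar]. *)
  rewrite -!mulrA ler_wpM2r ?mulr_ge0 ?expR_ge0// ler_wsqrtr//.
  rewrite ler_pdivlMr ?subr_gt0// mulrAC ler_pdivrMr ?subr_gt0//; nra.
have [LMinv [inv int LMinv_le]] :=
  coercive_inverse Vfin LM_V LM_linear A_linear A_le (ltW eps0) eps1 lam0 coer.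
exists LMinv; split => //.
apply: ge_ereal_sup => _ [x [Vx x1] <-]; rewrite lee_fin.
(* The inverse is in fact bounded by $1/\lambda_M$; the factor [C] enters through $|x| \le 1 \le
   C$. *)
rewrite (le_trans (LMinv_le _ Vx))// mulrC ler_pM ?invr_ge0 ?(ltW lam0)//.
exact: le_trans C1.
Unshelve. all: end_near. Qed.
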